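(* Assume that there exist a nonnegative function $\varphi\in C^2(\mathbb{R}^d)$, with $\varphi(x)\to+\infty$ as $|x|\to+\infty$, and constants $a,c>0$ and $t_0\in I$ such that $$(\mathcal{A}(t)\varphi)(x)\le a-c\varphi(x),\qquad t\ge t_0,\ x\in\mathbb{R}^d.$$ Then there exist an evolution system of measures $(\mu_t)_{t\in I}$ for $\{G(t,s)\}$ and a constant $M\ge0$ such that $$\int_{\mathbb{R}^d}\varphi(y)\,\mu_t(dy)\le M,\qquad t\ge t_0.$$
   Context: $d\ge 1$ is an integer and $I\subset\mathbb{R}$ is an interval which is either $\mathbb{R}$ or a right halfline. For $t\in I$ and smooth $\varphi:\mathbb{R}^d\to\mathbb{R}$, $$(\mathcal{A}(t)\varphi)(x)=\sum_{i,j=1}^d q_{ij}(t,x)D_{ij}\varphi(x)+\sum_{i=1}^d b_i(t,x)D_i\varphi(x),$$ with $Q=(q_{ij})$, $b=(b_i)$. Assumptions: (1) for some $\alpha\in(0,1)$, all $q_{ij},b_i$ belong to $C^{\alpha/2,\alpha}_{\rm loc}(I\times\mathbb{R}^d)$, i.e. they are $\alpha$-Hölder continuous with respect to the parabolic distance on every compact subset of $I\times\mathbb{R}^d$; (2) for every $(t,x)\in I\times\mathbb{R}^d$ the matrix $Q(t,x)$ is symmetric, and there is a function $\eta:I\times\mathbb{R}^d\to\mathbb{R}$ with $0<\eta_0:=\inf_{I\times\mathbb{R}^d}\eta$ and $\langle Q(t,x)\xi,\xi\rangle\ge\eta(t,x)|\xi|^2$ for all $\xi\in\mathbb{R}^d$,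 $(t,x)\in I\times\mathbb{R}^d$; (3) for every bounded interval $J\subset I$ there exist $\varphi_J\in C^2(\mathbb{R}^d)$ and $\lambda_J>0$ such that $\lim_{|x|\to+\infty}\varphi_J(x)=+\infty$ and $(\mathcal{A}(t)\varphi_J)(x)-\lambda_J\varphi_J(x)\le0$ for $(t,x)\in J\times\mathbb{R}^d$. Under (1)-(3), for every $s\in I$ and $f\in C_b(\mathbb{R}^d)$ (bounded continuous functions) there is a unique bounded classical solution $u_f\in C_b([s,+\infty)\times\mathbb{R}^d)\cap C^{1,2}((s,+\infty)\times\mathbb{R}^d)$ of $u_t=\mathcal{A}(t)u$ in $(s,+\infty)\times\mathbb{R}^d$, $u(s,\cdot)=f$; for $t>s$, $(G(t,s)f)(x)=u_f(t,x)$, and $G(t,t)=\mathrm{id}$. There are unique Borel probability measures $p_{t,s}(x,\cdot)$ with $(G(t,s)f)(x)=\int_{\mathbb{R}^d}f(y)\,p_{t,s}(x,dy)$ for $f\in C_b(\mathbb{R}^d)$, and by this formula $G(t,s)$ is extended to the space $B_b(\mathbb{R}^d)$ of bounded Borel functions. An evolution system of measures for $\{G(t,s)\}$ is a family $(\nu_t)_{t\in I}$ of Borel probability measures on $\mathbb{R}^d$ such that $\int_{\mathbb{R}^d}G(t,s)f\,d\nu_t=\int_{\mathbb{R}^d}f\,d\nu_s$ for every $f\in B_b(\mathbb{R}^d)$ and every $s<t$ in $I$. *)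

(* Defs.v *)
From HB Require Import structures.
From mathcomp Require Import all_boot all_order all_algebra.
From mathcomp Require Import all_classical all_reals all_analysis.

Set Implicit Arguments.
Unset Strict Implicit.
Unset Printing Implicit Defensive.

Import Order.TTheory GRing.Theory Num.Theory.
Import numFieldNormedType.Exports.

Local Open Scope classical_set_scope.
Local Open Scope ring_scope.

(* The library norm on ['rV[R]_d] is the sup norm; it induces the same topology
   as the Euclidean norm. *)
Definition enorm (R : realType) (d : nat) (x : 'rV[R]_d) : R :=
  Num.sqrt (\sum_(i < d) x 0 i ^+ 2).

Notation Borel R d := (g_sigma_algebraType (@open 'rV[R]_d)).

Definition unit_vec (R : realType) (d : nat) (i : 'I_d) : 'rV[R]_d :=
  delta_mx 0 i.

Definition Di (R : realType) (d : nat) (i : 'I_d) (f : 'rV[R]_d -> R)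
    (x : 'rV[R]_d) : R :=
  'D_(unit_vec R i) f x.

Definition Dij (R : realType) (d : nat) (i j : 'I_d) (f : 'rV[R]_d -> R)
    (x : 'rV[R]_d) : R :=
  Di i (Di j f) x.

Definition twice_differentiable_at (R : realType) (d : nat)
    (f : 'rV[R]_d -> R) (x : 'rV[R]_d) : Prop :=
  (forall i, derivable f x (unit_vec R i)) /\
  (forall i j, derivable (Di j f) x (unit_vec R i)).

Definition C2 (R : realType) (d : nat) (f : 'rV[R]_d -> R) : Prop :=
  [/\ continuous f,
      forall x, twice_differentiable_at f x,
      forall i, continuous (Di i f) &
      forall i j, continuous (Dij i j f)].

Definition Cb (R : realType) (d : nat) (f : 'rV[R]_d -> R) : Prop :=
  continuous f /\ [bounded f x | x in [set: 'rV[R]_d]].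

Definition Bb (R : realType) (d : nat) (f : 'rV[R]_d -> R) : Prop :=
  measurable_fun [set: Borel R d] (f : Borel R d -> R) /\
  [bounded f x | x in [set: 'rV[R]_d]].

Definition tends_to_infinity (R : realType) (d : nat) (f : 'rV[R]_d -> R) :
    Prop :=
  forall M : R, exists r : R, forall x, r < enorm x -> M <= f x.

Definition line_or_right_halfline (R : realType) (I : interval R) : Prop :=
  I = `]-oo, +oo[ \/ exists a : R, I = `]a, +oo[ \/ I = `[a, +oo[.

Definition parabolic_dist (R : realType) (d : nat) (z w : R * 'rV[R]_d) : R :=
  enorm (z.2 - w.2) + Num.sqrt `|z.1 - w.1|.

(* The class C^{alpha/2, alpha}_loc (I x R^d). *)
Definition parabolic_holder_loc (R : realType) (d : nat) (alpha : R)
    (I : interval R) (g : R -> 'rV[R]_d -> R) : Prop :=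
  forall K : set (R * 'rV[R]_d),
    compact K -> K `<=` [set` I] `*` setT ->
    exists C : R, forall z w, K z -> K w ->
      `|g z.1 z.2 - g w.1 w.2| <= C * parabolic_dist z w `^ alpha.

Definition operatorA (R : realType) (d : nat)
    (Q : R -> 'rV[R]_d -> 'M[R]_d) (b : R -> 'rV[R]_d -> 'rV[R]_d)
    (t : R) (f : 'rV[R]_d -> R) (x : 'rV[R]_d) : R :=
  \sum_(i < d) \sum_(j < d) Q t x i j * Dij i j f x +
  \sum_(i < d) b t x 0 i * Di i f x.

Definition holder_coefficients (R : realType) (d : nat) (I : interval R)
    (Q : R -> 'rV[R]_d -> 'M[R]_d) (b : R -> 'rV[R]_d -> 'rV[R]_d) : Prop :=
  exists alpha : R,
    [/\ 0 < alpha < 1,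
        forall i j, parabolic_holder_loc alpha I (fun t x => Q t x i j) &
        forall i, parabolic_holder_loc alpha I (fun t x => b t x 0 i)].

(* [inf] is 0 on sets that are not bounded below, so [0 < inf _] contains the
   fact that [eta] is bounded below on I x R^d. *)
Definition uniformly_elliptic (R : realType) (d : nat) (I : interval R)
    (Q : R -> 'rV[R]_d -> 'M[R]_d) : Prop :=
  (forall t x, t \in I -> (Q t x)^T = Q t x) /\
  exists eta : R -> 'rV[R]_d -> R,
    0 < inf [set eta z.1 z.2 | z in [set` I] `*` [set: 'rV[R]_d]] /\
    forall t x (xi : 'rV[R]_d), t \in I ->
      eta t x * enorm xi ^+ 2 <=
        \sum_(i < d) (\sum_(j < d) Q t x i j * xi 0 j) * xi 0 i.

Definition lyapunov_condition (R : realType) (d : nat) (I : interval R)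
    (Q : R -> 'rV[R]_d -> 'M[R]_d) (b : R -> 'rV[R]_d -> 'rV[R]_d) : Prop :=
  forall J : interval R, bounded_set [set` J] -> [set` J] `<=` [set` I] ->
    exists (phi : 'rV[R]_d -> R) (lambda : R),
      [/\ C2 phi, 0 < lambda, tends_to_infinity phi &
          forall t x, t \in J -> operatorA Q b t phi x - lambda * phi x <= 0].

(* [C^{1,2}((s, +oo) x R^d)]; values of [u] at times [t <= s] are irrelevant. *)
Definition C12_after (R : realType) (d : nat) (s : R)
    (u : R -> 'rV[R]_d -> R) : Prop :=
  let D := [set z : R * 'rV[R]_d | s < z.1] in
  [/\ {within D, continuous (fun z => u z.1 z.2)},
      forall t x, s < t ->
        derivable (fun r => u r x) t 1 /\ twice_differentiable_at (u t) x,
      {within D, continuous (fun z => derive1 (fun r => u r z.2) z.1)},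
      forall i, {within D, continuous (fun z => Di i (u z.1) z.2)} &
      forall i j, {within D, continuous (fun z => Dij i j (u z.1) z.2)}].

Definition bounded_classical_solution (R : realType) (d : nat)
    (Q : R -> 'rV[R]_d -> 'M[R]_d) (b : R -> 'rV[R]_d -> 'rV[R]_d)
    (s : R) (f : 'rV[R]_d -> R) (u : R -> 'rV[R]_d -> R) : Prop :=
  let D := [set z : R * 'rV[R]_d | s <= z.1] in
  [/\ {within D, continuous (fun z => u z.1 z.2)},
      [bounded u z.1 z.2 | z in D],
      C12_after s u,
      forall t x, s < t -> derive1 (fun r => u r x) t = operatorA Q b t (u t) x &
      forall x, u s x = f x].

(* [G t s f x] stands for (G(t,s)f)(x) and is meaningful for [s <= t] in [I].
   Bounded classical solutions are unique under [lyapunov_condition], so the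
   first clause determines G(t,s) on bounded continuous functions; the second
   one represents it by the probability measures [p t s x] and extends it to
   bounded Borel functions by the same formula. *)
Definition evolution_operator (R : realType) (d : nat) (I : interval R)
    (Q : R -> 'rV[R]_d -> 'M[R]_d) (b : R -> 'rV[R]_d -> 'rV[R]_d)
    (p : R -> R -> 'rV[R]_d -> probability (Borel R d) R)
    (G : R -> R -> ('rV[R]_d -> R) -> 'rV[R]_d -> R) : Prop :=
  (forall s f, s \in I -> Cb f ->
     bounded_classical_solution Q b s f (fun t => G t s f)) /\
  (forall s t f x, s \in I -> s <= t -> Bb f ->
     (G t s f x)%:E = (\int[p t s x]_y (f y)%:E)%E).

Definition evolution_system_of_measures (R : realType) (d : nat)
    (I : interval R) (G : R -> R -> ('rV[R]_d -> R) -> 'rV[R]_d -> R)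
    (nu : R -> probability (Borel R d) R) : Prop :=
  forall s t f, s \in I -> t \in I -> s < t -> Bb f ->
    (\int[nu t]_x (G t s f x)%:E = \int[nu s]_x (f x)%:E)%E.

(* Main.v *)
Require Import Defs.
From HB Require Import structures.
From mathcomp Require Import all_boot all_order all_algebra ring lra.
From mathcomp Require Import all_classical all_reals all_analysis.
From mathcomp Require Import measurable_realfun giry.

Set Implicit Arguments.
Unset Strict Implicit.
Unset Printing Implicit Defensive.

Import Order.TTheory GRing.Theory Num.Theory.
Import numFieldNormedType.Exports.

Local Open Scope classical_set_scope.
Local Open Scope ring_scope.

(* For a fixed base point and a fixed s, the measures p_{t,s}(0,.), t >= s >= t0,
   are tight: by the maximum principle e^{-c(t-s)}phi plus a suitable function of
   time dominates G(t,s)(min(phi,N)), so the integrals of phi stay bounded.  Take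
   an ultrafilter F on the line finer than the neighbourhoods of +oo and put
   L_s f = lim_F G(t,s)f(0) on bounded continuous f.  Uniqueness of bounded
   solutions gives G(r,t)G(t,s) = G(r,s), hence L_t(G(t,s)f) = L_s f, for all
   s < t at once and without a diagonal extraction.  Tightness makes L_s a Daniell
   functional for s >= t0, and L_s = L_{t0} o G(t0,s) does so for s < t0; the
   measures representing the L_s form the evolution system. *)

(** * Second order conditions at a maximum *)

(** The obstacle is countable additivity. A limit of integrals along an ultrafilter is linear,
    positive and normalized, but mass may escape to infinity, and then no probability measure
    represents it. The measure is therefore built from the functional: countable covers by
    nonnegative functions of [Cb] give an outer measure for which open sets are measurable. Only the
    inequality between the integral of [f] and [L f] for [f >= 0] is proved directly; equality
    follows by applying it to [M + f] and [M - f], because both sides give constants their own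
    value. The truncations of [phi] are forced because the Cauchy problem is posed for bounded data;
    what matters is that their bound does not depend on [N]. The equation controls [G] on continuous
    data only. The invariance identity reaches bounded Borel functions as an equality of two
    measures, tested on open sets. The maximum principle starts from second order conditions in
    arbitrary directions, whereas [C2] speaks of coordinate directions only; hence the lemmas on
    directional derivatives. *)

Lemma is_derive_line (R : realType) (V : normedModType R) (f : V -> R)
    (x e : V) (t : R) :
  derivable f (x + t *: e) e ->
  is_derive t 1 (fun r : R => f (x + r *: e)) ('D_e f (x + t *: e)).
Proof.
have E : (fun h : R => h^-1 *: (((fun r : R => f (x + r *: e)) \o shift t) (h *: 1)
      - f (x + t *: e))) =
    (fun h : R => h^-1 *: ((f \o shift (x + t *: e)) (h *: e) - f (x + t *: e))).
  apply/funext => h /=; congr (_ *: (f _ - _)).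
  by rewrite scalerDl [h%:A]mulr1 addrCA.
move=> df; apply: DeriveDef; first by rewrite /derivable E.
by rewrite /derive E.
Qed.

Lemma mvt_line (R : realType) (V : normedModType R) (f : V -> R) (x e : V) (t : R) :
  (forall y, derivable f y e) ->
  exists2 c : R, `|c| <= `|t| & f (x + t *: e) - f x = t * 'D_e f (x + c *: e).
Proof.
move=> df.
have dl (r : R) : is_derive (r : R) (1 : R) (fun r : R => f (x + r *: e)) ('D_e f (x + r *: e)).
  exact: is_derive_line.
have cl A : {within A, continuous (fun r : R => f (x + r *: e))}.
  apply: continuous_subspaceT => r; apply: differentiable_continuous.
  by apply/derivable1_diffP; exact: (@ex_derive _ _ _ _ _ _ _ (dl r)).
have [t0|t0] := leP 0 t.
- have [c] := MVT_segment t0 (fun r _ => dl r) (cl _).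
  rewrite in_itv/= => /andP[c0 ct]; rewrite scale0r addr0 subr0 mulrC => E.
  by exists c => //; rewrite !ger0_norm.
- have [c] := MVT_segment (ltW t0) (fun r _ => dl r) (cl _).
  rewrite in_itv/= => /andP[c0 ct]; rewrite scale0r addr0 sub0r mulrN => E.
  exists c; first by rewrite !ler0_norm ?lerN2// ltW.
  by rewrite -opprB E opprK mulrC.
Qed.

(** Additivity in the direction is not automatic for directional derivatives. The increment along
    [v + a *: w] is a step along [v] followed by one along [w]; the mean value theorem turns the
    second into ['D_w f] at a point that tends to [x], where continuity applies. *)
Lemma is_derive_addv (R : realType) (V : normedModType R) (f : V -> R)
    (x v w : V) (a : R) :
  derivable f x v -> (forall y, derivable f y w) ->
  {for x, continuous ('D_w f)} ->
  is_derive x (v + a *: w) f ('D_v f x + a * 'D_w f x).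
Proof.
move=> fv fw cw.
suff H : (fun h : R => h^-1 *: ((f \o shift x) (h *: (v + a *: w)) - f x)) @ 0^'
    --> 'D_v f x + a * 'D_w f x.
  apply: DeriveDef; first by apply/cvg_ex; eexists; exact: H.
  exact: cvg_lim H.
have E h : f (h *: (v + a *: w) + x) - f x =
  (f (h *: v + x + (h * a) *: w) - f (h *: v + x)) + (f (h *: v + x) - f x).
  by rewrite addrA subrK scalerDr scalerA addrAC.
have -> : (fun h : R => h^-1 *: ((f \o shift x) (h *: (v + a *: w)) - f x)) =
  (fun h : R => h^-1 *: (f (h *: v + x) - f x)) \+
  (fun h : R => h^-1 *: (f (h *: v + x + (h * a) *: w) - f (h *: v + x))).
  by apply/funext => h /=; rewrite E scalerDr addrC.
apply: cvgD; first exact: fv.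
have /choice[g gP] : forall h : R, exists c : R, `|c| <= `|h * a| /\
    f (h *: v + x + (h * a) *: w) - f (h *: v + x) =
    (h * a) * 'D_w f (h *: v + x + c *: w).
  by move=> h; have [c] := mvt_line (h *: v + x) (h * a) fw; exists c.
have cvg0 : (fun h : R => h *: v + x + g h *: w) @ 0^' --> x.
  rewrite -[X in _ --> X]addr0 -[X in _ --> X + _]add0r; apply: cvgD.
    apply: cvgD; last exact: cvg_cst.
    rewrite -[X in _ --> X](scale0r v); apply: cvgZr_tmp.
    exact: cvg_within.
  rewrite -[X in _ --> X](scale0r w); apply: cvgZr_tmp.
  have H : (fun h : R => h * a) @ 0^' --> 0.
    rewrite -[X in _ --> X](mul0r a); apply: cvgMr_tmp.
    exact: cvg_within.
  apply/cvgr0Pnorm_le => e e0; move/cvgr0Pnorm_le/(_ e e0) : H.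
  by apply: filterS => h; apply: le_trans; exact: (gP h).1.
have H := cvgMl_tmp (a := a) (cvg_comp _ _ cvg0 cw).
apply: cvg_trans (H _); apply: near_eq_cvg.
near=> h; have h0 : h != 0 by near: h; exact: nbhs_dnbhs_neq.
rewrite /= (gP h).2 [RHS]/( _ *: _) /=.
by rewrite -[RHS]/(h^-1 * _) !mulrA mulVf// mul1r.
Unshelve. all: by end_near. Qed.

Lemma is_derive_row (R : realType) (d : nat) (f : 'rV[R]_d -> R)
    (x xi : 'rV[R]_d) :
  (forall i y, derivable f y (unit_vec R i)) ->
  (forall i, continuous (Di i f)) ->
  is_derive x xi f (\sum_(i < d) xi 0 i * Di i f x).
Proof.
move=> df cf; rewrite [X in is_derive _ X](row_sum_delta xi).
elim/big_rec2 : _ => [|i v a _ [dv <-]]; first exact: is_derive0.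
rewrite addrC [X in is_derive _ _ _ X]addrC.
by apply: (is_derive_addv _ dv (df i)); exact: cf.
Qed.

Lemma derive_max_eq0 (R : realType) (V : normedModType R) (f : V -> R)
    (x e : V) :
  (forall y, derivable f y e) -> (forall y, f y <= f x) -> 'D_e f x = 0.
Proof.
move=> df fmax.
have dl (r : R) : is_derive r (1 : R) (fun r : R => f (x + r *: e))
    ('D_e f (x + r *: e)) by exact: is_derive_line.
have [_ D0] : is_derive (0 : R) (1 : R) (fun r : R => f (x + r *: e)) 0.
  apply: (@derive1_at_max _ _ (-1) 1).
  - by lra.
  - by move=> t _; have [] := dl t.
  - by rewrite in_itv/= oppr_lt0 ltr01.
  - by move=> t _; rewrite scale0r addr0.
by have [_] := dl 0; rewrite scale0r addr0 D0.
Qed.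

(** If the form were positive at [xi], the derivative [k] of [f] along [xi], which vanishes at the
    maximum, would be positive at [x + c *: xi] for all small [c > 0]. The mean value theorem would
    then produce a value of [f] above [f x]. *)
Lemma hessian_max_le0 (R : realType) (d : nat) (f : 'rV[R]_d -> R)
    (x xi : 'rV[R]_d) :
  C2 f -> (forall y, f y <= f x) ->
  \sum_(i < d) \sum_(j < d) Dij i j f x * (xi 0 i * xi 0 j) <= 0.
Proof.
move=> [cf df cD cDD] fmax; rewrite leNgt; apply/negP => H0.
have dfx i y : derivable f y (unit_vec R i) by exact: (df y).1.
have dx y : is_derive y xi f (\sum_(i < d) xi 0 i * Di i f y).
  exact: is_derive_row.
have dl (r : R) : is_derive r (1 : R) (fun r : R => f (x + r *: xi))
    ((\sum_(i < d) xi 0 i * Di i f (x + r *: xi))).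
  have [dr <-] := dx (x + r *: xi); exact: is_derive_line.
have cl A : {within A, continuous (fun r : R => f (x + r *: xi))}.
  apply: continuous_subspaceT => r; apply: differentiable_continuous.
  by apply/derivable1_diffP; exact: (@ex_derive _ _ _ _ _ _ _ (dl r)).
have ddx j y : is_derive y xi (Di j f) (\sum_(i < d) xi 0 i * Dij i j f y).
  apply: is_derive_row => i; last exact: cDD.
  by move=> z; exact: (df z).2.
pose k := \sum_(j < d) (fun y => xi 0 j *: Di j f y).
have kE y : k y = \sum_(i < d) xi 0 i * Di i f y by rewrite /k fct_sumE.
have dk : is_derive x xi k
    (\sum_(j < d) xi 0 j *: \sum_(i < d) xi 0 i * Dij i j f x).
  by rewrite /k; apply: is_derive_sum.
have k0 : k x = 0.
  rewrite kE big1// => i _; rewrite /Di derive_max_eq0 ?mulr0//.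
have : 'D_xi k x > 0.
  have [_ ->] := dk; move: H0; rewrite exchange_big/=.
  congr (0 < _); apply: eq_bigr => j _; rewrite scaler_sumr.
  by apply: eq_bigr => i _; rewrite /GRing.scale/= mulrC -mulrA mulrCA.
have [/cvg_ex[l kl] _] := dk.
rewrite /derive (cvg_lim _ kl)// => l0.
have := cvgr_gt _ kl _ l0; move=> [e/= e0 eP].
have e20 : 0 < e / 2 by rewrite divr_gt0.
have [c] := MVT e20 (fun r _ => dl r) (cl _).
rewrite in_itv/= => /andP[c0 ce]; rewrite scale0r addr0 subr0 -kE => E.
have := fmax (x + (e / 2) *: xi); rewrite leNgt => /negP; apply.
rewrite -subr_gt0 E mulr_gt0//.
have := eP c; rewrite /ball/= sub0r normrN gtr0_norm// => /(_ _ _)/=.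
rewrite k0 subr0 addrC /GRing.scale/= pmulr_rgt0 ?invr_gt0//; apply.
  by rewrite (lt_trans ce)// ltr_pdivrMr// ltr_pMr// ltr1n.
by rewrite gt_eqF.
Qed.

(* Induction on the size: subtracting the rank one matrix [w w^T / Q 0 0], where
   [w] is the first column of [Q], leaves the Schur complement, which is again
   positive definite. *)
Lemma trace_mul_le0 (R : realFieldType) (n : nat) (Q H : 'I_n -> 'I_n -> R) :
  (forall i j, Q i j = Q j i) ->
  (forall y : 'I_n -> R, (exists i, y i != 0) ->
     0 < \sum_(i < n) \sum_(j < n) Q i j * (y i * y j)) ->
  (forall y : 'I_n -> R, \sum_(i < n) \sum_(j < n) H i j * (y i * y j) <= 0) ->
  \sum_(i < n) \sum_(j < n) Q i j * H i j <= 0.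
Proof.
elim: n Q H => [|n IH] Q H sQ pQ nH; first by rewrite big_ord0.
set a := Q ord0 ord0.
have a0 : 0 < a.
  have := pQ (fun i => (i == ord0)%:R); rewrite big_ord_recl big_ord_recl/=.
  rewrite !mulr1 big1 ?addr0; last by move=> i _; rewrite !mulr0.
  rewrite big1 ?addr0; last first.
    by move=> i _; rewrite big1// => j _; rewrite mul0r mulr0.
  by apply; exists ord0; rewrite eqxx oner_eq0.
pose w i := Q i ord0.
pose S i j := Q i j - w i * w j / a.
have S0r i : S i ord0 = 0 by rewrite /S /w -/a mulfK ?gt_eqF// subrr.
have S0l i : S ord0 i = 0.
  by rewrite /S /w -/a mulrC mulKf ?gt_eqF// sQ subrr.
have -> : \sum_(i < n.+1) \sum_(j < n.+1) Q i j * H i j =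
    a^-1 * (\sum_(i < n.+1) \sum_(j < n.+1) H i j * (w i * w j)) +
    \sum_(i < n.+1) \sum_(j < n.+1) S i j * H i j.
  rewrite mulr_sumr -big_split/=; apply: eq_bigr => i _.
  rewrite mulr_sumr -big_split/=; apply: eq_bigr => j _.
  rewrite /S mulrBl addrCA [X in _ + (X - _)]mulrCA [H i j * _]mulrC.
  by rewrite [w i * w j / a]mulrC -[a^-1 * _ * _]mulrA subrr addr0.
have D0 (F : 'I_n.+1 -> 'I_n.+1 -> R) :
  (forall i, F i ord0 = 0) -> (forall i, F ord0 i = 0) ->
  \sum_(i < n.+1) \sum_(j < n.+1) F i j =
  \sum_(i < n) \sum_(j < n) F (lift ord0 i) (lift ord0 j).
  move=> F1 F2; rewrite big_ord_recl big1 ?add0r; last by move=> j _.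
  by apply: eq_bigr => i _; rewrite big_ord_recl F1 add0r.
rewrite -[leRHS]addr0; apply: lerD; first by rewrite pmulr_rle0 ?invr_gt0.
rewrite D0; last 2 first.
- by move=> i; rewrite S0r mul0r.
- by move=> i; rewrite S0l mul0r.
apply: IH => [i j|y [i0 yi0]|y].
- by rewrite /S sQ [w _ * w _]mulrC.
- pose W := \sum_(i < n) w (lift ord0 i) * y i.
  (* The first coordinate [- (W / a)] minimizes the form of [Q] among all vectors extending [y], and
     the minimum is the form of [S] at [y]. *)
  pose z (i : 'I_n.+1) := if unlift ord0 i is Some j then y j else - (W / a).
  have z0 : z ord0 = - (W / a) by rewrite /z unlift_none.
  have zS i : z (lift ord0 i) = y i by rewrite /z liftK.
  have := pQ z; rewrite big_ord_recl.
  rewrite [X in X + _]big_ord_recl/= z0 -/a.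
  have -> : \sum_(i < n) Q ord0 (lift ord0 i) * (- (W / a) * z (lift ord0 i)) =
     - (W / a) * W.
    rewrite {3}/W mulr_sumr; apply: eq_bigr => i _; rewrite zS /w sQ.
    by rewrite mulrCA.
  have -> : \sum_(i < n) \sum_(j < n.+1)
      Q (lift ord0 i) j * (z (lift ord0 i) * z j) =
    - (W / a) * W + \sum_(i < n) \sum_(j < n)
      Q (lift ord0 i) (lift ord0 j) * (y i * y j).
    rewrite {2}/W mulr_sumr -big_split/=; apply: eq_bigr => i _.
    rewrite big_ord_recl zS z0 /w; congr (_ + _).
      by rewrite mulrC -mulrA mulrCA [y i * _]mulrC.
    by apply: eq_bigr => j _; rewrite zS.
  have -> : \sum_(i < n) \sum_(j < n) S (lift ord0 i) (lift ord0 j) * (y i * y j) =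
    \sum_(i < n) \sum_(j < n) Q (lift ord0 i) (lift ord0 j) * (y i * y j)
     - W * W / a.
    rewrite -mulrA {1}/W mulr_suml -sumrB; apply: eq_bigr => i _.
    rewrite /W mulr_suml mulr_sumr -sumrB; apply: eq_bigr => j _.
    by rewrite /S; field; exact: lt0r_neq0.
  move=> Hz; suff E : forall T, a * (- (W / a) * - (W / a)) + - (W / a) * W +
      (- (W / a) * W + T) = T - W * W / a.
    by rewrite -E; apply: Hz; exists (lift ord0 i0); rewrite zS.
  by move=> T; field; exact: lt0r_neq0.
- pose z (i : 'I_n.+1) := if unlift ord0 i is Some j then y j else 0.
  have := nH z; rewrite D0; last 2 first.
  + by move=> i; rewrite /z unlift_none !mulr0.
  + by move=> i; rewrite /z unlift_none mul0r mulr0.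
  congr (_ <= _); apply: eq_bigr => i _; apply: eq_bigr => j _.
  by rewrite /z !liftK.
Qed.

(** * Maximum principle *)

Lemma norm_le_enorm (R : realType) (d : nat) (x : 'rV[R]_d) : `|x| <= enorm x.
Proof.
rewrite [leLHS]mx_normrE; apply/bigmax_leP; split=> /=.
  exact: sqrtr_ge0.
move=> [i j] _ /=; rewrite (ord1 i) -sqrtr_sqr /enorm; apply: ler_wsqrtr.
by rewrite (bigD1 j)//= lerDl sumr_ge0// => k _; exact: sqr_ge0.
Qed.

Lemma enorm_gt0 (R : realType) (d : nat) (x : 'rV[R]_d) :
  (exists i, x 0 i != 0) -> 0 < enorm x.
Proof.
move=> [i xi]; rewrite sqrtr_gt0 (bigD1 i)//= ltr_wpDr//.
  by rewrite sumr_ge0// => k _; exact: sqr_ge0.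
by rewrite lt_neqAle sqr_ge0 eq_sym sqrf_eq0 xi.
Qed.

Lemma compact_norm_le (R : realType) (d : nat) (r : R) :
  compact [set x : 'rV[R]_d | `|x| <= r].
Proof.
apply: bounded_closed_compact.
  exists r; split; first exact: num_real.
  by move=> M rM x /= /le_trans; apply; exact: ltW.
apply: (@closed_comp _ _ (fun x : 'rV[R]_d => `|x|) [set y | y <= r]).
  by move=> x _; exact: norm_continuous.
exact: closed_le.
Qed.

(** Only earlier times are compared, since a maximum over a time segment may sit at its right end;
    hence a sign instead of a vanishing derivative. *)
Lemma derive1_left_max_ge0 (R : realType) (f : R -> R) (s t : R) :
  s < t -> derivable f t 1 -> (forall r, s < r < t -> f r <= f t) ->
  0 <= derive1 f t.
Proof.
move=> st df fmax; rewrite leNgt derive1E; apply/negP => neg.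
have /cvg_ex[l kl] := df.
move: neg; rewrite /derive (cvg_lim _ kl)// => l0.
have := cvgr_lt _ kl _ l0; move=> [e/= e0 eP].
pose h := Num.min (e / 2) ((t - s) / 2).
have h0 : 0 < h by rewrite lt_min !divr_gt0// subr_gt0.
have he : h < e by rewrite gt_min ltr_pdivrMr// ltr_pMr// ltr1n.
have hts : h < t - s.
  have : h <= (t - s) / 2 by rewrite ge_min lexx orbT.
  lra.
have := eP (- h); rewrite /ball/= sub0r opprK gtr0_norm// => /(_ he).
rewrite oppr_eq0 gt_eqF// => /(_ isT).
rewrite /GRing.scale/= mulr1 invrN mulNr oppr_lt0 pmulr_rgt0 ?invr_gt0//.
rewrite subr_gt0 ltNge fmax//; apply/andP; split; lra.
Qed.

(** At a maximum the gradient vanishes, which removes the drift; what remains is the trace of a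
    positive definite matrix times a negative semidefinite one. *)
Lemma operatorA_max_le0 (R : realType) (d : nat)
    (Q : R -> 'rV[R]_d -> 'M[R]_d) (b : R -> 'rV[R]_d -> 'rV[R]_d)
    (t : R) (f : 'rV[R]_d -> R) (x : 'rV[R]_d) :
  (Q t x)^T = Q t x ->
  (forall xi : 'rV[R]_d, (exists i, xi 0 i != 0) ->
    0 < \sum_(i < d) (\sum_(j < d) Q t x i j * xi 0 j) * xi 0 i) ->
  C2 f -> (forall y, f y <= f x) -> operatorA Q b t f x <= 0.
Proof.
move=> sQ pQ C2f fmax; rewrite /operatorA [X in _ + X]big1 ?addr0; last first.
  move=> i _; rewrite /Di derive_max_eq0 ?mulr0//.
  by move=> y; have [_ /(_ y)[]] := C2f.
apply: trace_mul_le0 => [i j|y [k yk]|y].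
- by rewrite -{1}sQ mxE.
- have := pQ (\row_i y i) (ex_intro _ k _); rewrite mxE => /(_ yk).
  congr (0 < _); apply: eq_bigr => i _; rewrite mulr_suml; apply: eq_bigr => j _.
  by rewrite !mxE -mulrA [y j * _]mulrC.
- have := hessian_max_le0 (\row_i y i) C2f fmax.
  congr (_ <= 0); apply: eq_bigr => i _; apply: eq_bigr => j _.
  by rewrite !mxE.
Qed.

(** A positive maximum over the compact cylinder is not at time [s], and at its own time it is a
    maximum over the whole space, because [w] is nonpositive off the ball. There the time derivative
    is at least 0 and [operatorA] is at most 0, which contradicts the strict inequality without any
    perturbation. *)
Lemma max_principle (R : realType) (d : nat)
    (Q : R -> 'rV[R]_d -> 'M[R]_d) (b : R -> 'rV[R]_d -> 'rV[R]_d)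
    (s T r : R) (w : R -> 'rV[R]_d -> R) :
  (forall t x, s < t -> (Q t x)^T = Q t x) ->
  (forall t x (xi : 'rV[R]_d), s < t -> (exists i, xi 0 i != 0) ->
    0 < \sum_(i < d) (\sum_(j < d) Q t x i j * xi 0 j) * xi 0 i) ->
  {within [set z : R * 'rV[R]_d | s <= z.1], continuous (fun z => w z.1 z.2)} ->
  (forall t x, s < t -> derivable (w ^~ x) t 1) ->
  (forall t, s < t -> C2 (w t)) ->
  (forall t x, s < t <= T -> derive1 (w ^~ x) t < operatorA Q b t (w t) x) ->
  (forall x, w s x <= 0) ->
  (forall t x, s <= t <= T -> r < `|x| -> w t x <= 0) ->
  forall t x, s <= t <= T -> w t x <= 0.
Proof.
move=> sQ pQ cw dw C2w sub w0 wr t1 x1 t1sT; rewrite leNgt; apply/negP => w1.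
pose K : set (R * 'rV[R]_d) := `[s, T] `*` [set x | `|x| <= r].
have Kx1 : K (t1, x1).
  split; rewrite /= ?in_itv//=; rewrite leNgt; apply/negP => rx1.
  by move: w1; rewrite ltNge wr.
have cK : compact K.
  by apply: compact_setX; [exact: segment_compact|exact: compact_norm_le].
have [|[t x] /set_mem[/= tsT xr] wmax] := @compact_EVT_max _ _
    (fun z => w z.1 z.2) K (ex_intro _ _ Kx1) cK.
  apply: continuous_subspaceW cw => -[t x] [/=].
  by rewrite in_itv/= => /andP[].
have wtx : 0 < w t x by apply: lt_le_trans w1 (wmax (t1, x1) _); exact/mem_set.
move: tsT; rewrite in_itv/= => /andP[st tT].
have {}st : s < t.
  rewrite lt_neqAle st andbT; apply/eqP => stE.
  by move: wtx; rewrite -stE ltNge w0.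
have := sub t x; rewrite st tT => /(_ isT); rewrite ltNge => /negP; apply.
apply: (@le_trans _ _ 0).
  apply: operatorA_max_le0 => [|xi|//|y]; [exact: sQ|exact: pQ|exact: C2w|].
  have [yr|ry] := leP `|y| r.
    by apply: (wmax (t, y)); apply/mem_set; split; rewrite //= in_itv/= ltW.
  by apply: le_trans (ltW wtx); apply: wr => //; rewrite ltW.
apply: (derive1_left_max_ge0 st); first exact: dw.
move=> q /andP[sq qt]; apply: (wmax (q, x)); apply/mem_set; split => //=.
by rewrite in_itv/= (ltW sq)/= (le_trans (ltW qt)).
Qed.

Lemma bounded_existsP (R : realType) (T : Type) (f : T -> R) (A : set T) :
  [bounded f x | x in A] <->
  exists2 M, 0 < M & forall x, A x -> `|f x| <= M.
Proof.
split=> [[M [_ H]]|[M M0 H]].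
  exists (Num.max M 0 + 1); first by rewrite ltr_wpDl// le_max lexx orbT.
  by apply: H; rewrite ltr_pwDr// le_max lexx.
by exists M; split; [exact: num_real|move=> N MN x /H /le_trans; apply; exact: ltW].
Qed.

(** * Linearity of [operatorA] on [C2] functions *)

Lemma C2_cst (R : realType) (d : nat) (k : R) : C2 (fun _ : 'rV[R]_d => k).
Proof.
have D0 (i : 'I_d) : Di i (fun _ : 'rV[R]_d => k) = cst 0.
  by apply/funext => x; rewrite /Di derive_cst.
split=> [x|x|i|i j].
- exact: cst_continuous.
- by split=> *; rewrite ?D0; exact: derivable_cst.
- by rewrite D0; exact: cst_continuous.
- rewrite /Dij D0 (_ : Di i _ = cst 0); first by exact: cst_continuous.
  by apply/funext => x; rewrite /Di derive_cst.
Qed.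

Lemma operatorA_cst (R : realType) (d : nat)
    (Q : R -> 'rV[R]_d -> 'M[R]_d) (b : R -> 'rV[R]_d -> 'rV[R]_d)
    (t k : R) (x : 'rV[R]_d) : operatorA Q b t (fun _ => k) x = 0.
Proof.
have D0 (i : 'I_d) : Di i (fun _ : 'rV[R]_d => k) = cst 0.
  by apply/funext => y; rewrite /Di derive_cst.
rewrite /operatorA !big1 ?addr0// => i _; first by rewrite D0 mulr0.
by rewrite big1// => j _; rewrite /Dij D0 /Di derive_cst mulr0.
Qed.

Lemma is_derive_addZ (R : realType) (V : normedModType R) (f g : V -> R)
    (k : R) (x v : V) : derivable f x v -> derivable g x v ->
  is_derive x v (fun y => f y + k * g y) ('D_v f x + k * 'D_v g x).
Proof.
move=> df dg; have dkg := @derivableZ _ _ _ g k _ _ dg.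
apply: DeriveDef; first exact: (derivableD df dkg).
by have := deriveD df dkg; rewrite (deriveZ k dg).
Qed.

Lemma Di_addZ (R : realType) (d : nat) (f g : 'rV[R]_d -> R) (k : R) (i : 'I_d) :
  (forall x, derivable f x (unit_vec R i)) ->
  (forall x, derivable g x (unit_vec R i)) ->
  Di i (fun x => f x + k * g x) = (fun x => Di i f x + k * Di i g x).
Proof.
by move=> df dg; apply/funext => x; have [] := is_derive_addZ k (df x) (dg x).
Qed.

Lemma Dij_addZ (R : realType) (d : nat) (f g : 'rV[R]_d -> R) (k : R) (i j : 'I_d) :
  (forall x, twice_differentiable_at f x) ->
  (forall x, twice_differentiable_at g x) ->
  Dij i j (fun x => f x + k * g x) = (fun x => Dij i j f x + k * Dij i j g x).
Proof.
move=> df dg; rewrite /Dij Di_addZ => [|x|x]; last 2 first.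
- by have [] := df x.
- by have [] := dg x.
by rewrite Di_addZ// => x; [have [] := df x|have [] := dg x].
Qed.

Lemma C2_addZ (R : realType) (d : nat) (f g : 'rV[R]_d -> R) (k : R) :
  C2 f -> C2 g -> C2 (fun x => f x + k * g x).
Proof.
move=> [cf df cDf cDDf] [cg dg cDg cDDg].
have cl (h1 h2 : 'rV[R]_d -> R) : continuous h1 -> continuous h2 ->
    continuous (fun x => h1 x + k * h2 x).
  by move=> c1 c2 x; apply: (cvgD (c1 x) (cvgMl_tmp (c2 x))).
have df1 i x : derivable f x (unit_vec R i) by have [] := df x.
have dg1 i x : derivable g x (unit_vec R i) by have [] := dg x.
split=> [|x|i|i j].
- exact: cl.
- split=> [i|i j]; first by have [] := is_derive_addZ k (df1 i x) (dg1 i x).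
  rewrite Di_addZ//; have [_ /(_ i j) df2] := df x; have [_ /(_ i j) dg2] := dg x.
  by have [] := is_derive_addZ k df2 dg2.
- by rewrite Di_addZ//; exact: cl.
- by rewrite Dij_addZ//; exact: cl.
Qed.

Lemma operatorA_addZ (R : realType) (d : nat)
    (Q : R -> 'rV[R]_d -> 'M[R]_d) (b : R -> 'rV[R]_d -> 'rV[R]_d)
    (t : R) (f g : 'rV[R]_d -> R) (k : R) (x : 'rV[R]_d) :
  C2 f -> C2 g ->
  operatorA Q b t (fun x => f x + k * g x) x =
    operatorA Q b t f x + k * operatorA Q b t g x.
Proof.
move=> [_ df _ _] [_ dg _ _].
rewrite /operatorA mulrDr addrACA; congr (_ + _).
  rewrite mulr_sumr -big_split/=; apply: eq_bigr => i _.
  rewrite mulr_sumr -big_split/=; apply: eq_bigr => j _.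
  by rewrite Dij_addZ// mulrDr mulrCA.
rewrite mulr_sumr -big_split/=; apply: eq_bigr => i _.
rewrite Di_addZ; last 2 first.
- by move=> y; have [] := df y.
- by move=> y; have [] := dg y.
by rewrite mulrDr mulrCA.
Qed.

(** * Comparison of bounded classical solutions *)

Lemma continuous_within_slice (R : realType) (V : topologicalType)
    (D : set (R * V)) (t : R) (g : R * V -> R) :
  {within D, continuous g} -> (forall x, D (t, x)) ->
  continuous (fun x => g (t, x)).
Proof.
move=> /subspace_continuousP cg Dt x.
apply: (cvg_comp (fun y => (t, y)) g _ (cg _ (Dt x))).
have Fx : Filter (nbhs x) by exact: nbhs_filter.
have H : (t, y) @[y --> nbhs x] --> (nbhs t, nbhs x).
  by apply: (cvg_pair (f := fun=> t)); [exact: cvg_cst|exact: cvg_id].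
move=> A DA.
exact: (@filterS _ (nbhs x) Fx (fun y => D (t, y) -> A (t, y))
  (fun y => A (t, y)) (fun y h => h (Dt y)) (H _ DA)).
Qed.

Lemma is_derive_expR_affine (R : realType) (k s c t : R) :
  is_derive t 1 (fun r => expR (k * (r - s)) * c) (k * expR (k * (t - s)) * c).
Proof.
have cD (a : R) : derivable (cst a) t 1 by exact: derivable_cst.
have iD : derivable (id : R -> R) t 1 by exact: derivable_id.
have h1 := is_derive_addZ k (cD (- (k * s))) iD.
have h2 := is_derive1_comp (is_derive_expR _) h1.
have [h3 h3E] := is_derive_addZ c (cD 0) (@ex_derive _ _ _ _ _ _ _ h2).
have E (r : R) : - (k * s) + k * r = k * (r - s) by rewrite mulrBr addrC.
have F : (fun r => 0 + c * (expR \o (fun y : R => - (k * s) + k * y)) r) =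
    (fun r => expR (k * (r - s)) * c).
  by apply/funext => r /=; rewrite E mulrC add0r.
rewrite -F; apply: DeriveDef; first exact: h3.
rewrite h3E derive_cst add0r (@derive_val _ _ _ _ _ _ _ h2).
by rewrite derive_cst derive_id add0r mulr1 E mulrC [expR _ * k]mulrC.
Qed.

Lemma C12_after_C2 (R : realType) (d : nat) (s t : R)
    (u : R -> 'rV[R]_d -> R) : C12_after s u -> s < t -> C2 (u t).
Proof.
move=> [cu du _ cD cDD] st; split=> [|x|i|i j].
- exact: (continuous_within_slice cu (fun=> st)).
- by have [] := du t x st.
- exact: (continuous_within_slice (cD i) (fun=> st)).
- exact: (continuous_within_slice (cDD i j) (fun=> st)).
Qed.

Lemma uniformly_elliptic_gt0 (R : realType) (d : nat) (I : interval R)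
    (Q : R -> 'rV[R]_d -> 'M[R]_d) (t : R) (x xi : 'rV[R]_d) :
  uniformly_elliptic I Q -> t \in I -> (exists i, xi 0 i != 0) ->
  0 < \sum_(i < d) (\sum_(j < d) Q t x i j * xi 0 j) * xi 0 i.
Proof.
move=> [_ [eta [+ etaP]]] tI xi0.
set S := (S in inf S) => S0.
apply: lt_le_trans (etaP t x xi tI); rewrite mulr_gt0 ?exprn_gt0 ?enorm_gt0//.
(* Without an infimum [inf S] would be the default value 0, which [S0] excludes; so [inf S] is a
   genuine lower bound of [eta]. *)
have [iS|niS] := pselect (has_inf S); last by rewrite inf_out// ltxx in S0.
apply: lt_le_trans S0 (ge_inf iS.2 _).
by exists (t, x).
Qed.

(** Since [u] and [v] are bounded and [psi] tends to infinity, [u - v - expR (k * (t - s)) * psi] is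
    nonpositive outside a ball, uniformly for times in [[s, T]]; this takes the place of a lateral
    boundary condition. The sign of [k] is left free: uniqueness takes a positive [k], the estimate
    of [phi] takes [- c]. *)
Lemma bounded_solution_le (R : realType) (d : nat) (I : interval R)
    (Q : R -> 'rV[R]_d -> 'M[R]_d) (b : R -> 'rV[R]_d -> 'rV[R]_d)
    (s T k : R) (f g psi : 'rV[R]_d -> R) (u v : R -> 'rV[R]_d -> R) :
  (forall t, s <= t -> t \in I) -> uniformly_elliptic I Q ->
  bounded_classical_solution Q b s f u ->
  bounded_classical_solution Q b s g v ->
  C2 psi -> tends_to_infinity psi ->
  (forall t x, s < t <= T -> operatorA Q b t psi x < k * psi x) ->
  (forall x, f x <= g x + psi x) ->
  forall t x, s <= t <= T -> u t x <= v t x + expR (k * (t - s)) * psi x.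
Proof.
move=> sI ell [cu /bounded_existsP[N N0 uN] C12u equ iniu].
move=> [cv /bounded_existsP[N1 N10 vN] C12v eqv iniv] C2psi psioo psiA fg t x tsT.
pose e t := expR (k * (t - s)).
pose w t x := (u t x + (- 1) * v t x) + (- 1) * (e t * psi x).
suff : w t x <= 0 by rewrite /w /e => ?; lra.
have wE t' : w t' =
    (fun x => (fun x => u t' x + (- 1) * v t' x) x + (- e t') * psi x).
  by apply/funext => y; rewrite /w; ring.
have C2u t' : s < t' -> C2 (u t') by exact: C12_after_C2.
have C2v t' : s < t' -> C2 (v t') by exact: C12_after_C2.
have C2uv t' : s < t' -> C2 (fun x => u t' x + (- 1) * v t' x).
  by move=> st; apply: C2_addZ; [exact: C2u|exact: C2v].
have duv t' x' : s < t' -> is_derive t' 1 (fun r => u r x' + (- 1) * v r x')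
    (operatorA Q b t' (fun x => u t' x + (- 1) * v t' x) x').
  move=> st; have [_ /(_ _ x' st)[du _] _ _ _] := C12u.
  have [_ /(_ _ x' st)[dv _] _ _ _] := C12v.
  have [D DE] := is_derive_addZ (- 1) du dv; apply: DeriveDef; first exact: D.
  rewrite DE operatorA_addZ; [|exact: C2u|exact: C2v].
  by rewrite -!derive1E equ// eqv.
have dw t' x' : s < t' -> is_derive t' 1 (w ^~ x')
    (operatorA Q b t' (fun x => u t' x + (- 1) * v t' x) x' +
     (- 1) * (k * e t' * psi x')).
  move=> st; have [D DE] := duv _ x' st.
  have [E EE] := is_derive_expR_affine k s (psi x') t'.
  have [F FE] := is_derive_addZ (- 1) D E.
  by apply: DeriveDef; [exact: F|rewrite -DE -EE -FE].
(* A lower bound for [expR (k * (t - s))] on [[s, T]] whatever the sign of [k]. Where [psi] exceeds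
   [(N + N1) / m], the exponential term therefore dominates the bounds of both solutions. *)
pose m := expR (- `|k| * (T - s)).
have m0 : 0 < m by exact: expR_gt0.
have N'0 : 0 <= N + N1 by rewrite addr_ge0// ltW.
have [r rP] := psioo ((N + N1) / m).
apply: (@max_principle R d Q b s T r w); last exact: tsT.
- by move=> t' x' st; have [+ _] := ell; apply; apply: sI; exact: ltW.
- by move=> t' x' xi st xi0; exact: (uniformly_elliptic_gt0 x' ell (sI _ (ltW st)) xi0).
- have ce : continuous (fun z : R * 'rV[R]_d => e z.1 * psi z.2).
    move=> z; apply: cvgM.
      apply: (cvg_comp (fun z : R * 'rV[R]_d => k * (z.1 - s)) expR).
        by apply: cvgMl_tmp; apply: (cvgB _ (cvg_cst s)); exact: cvg_fst.
      exact: continuous_expR.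
    apply: (cvg_comp (fun z : R * 'rV[R]_d => z.2) psi); first exact: cvg_snd.
    by have [cpsi _ _ _] := C2psi; exact: cpsi.
  have {}ce : {within [set z : R * 'rV[R]_d | s <= z.1],
      continuous (fun z : R * 'rV[R]_d => e z.1 * psi z.2)}.
    exact: continuous_subspaceT.
  by move=> z; apply: (cvgD (cvgD (cu z) (cvgMl_tmp (cv z))) (cvgMl_tmp (ce z))).
- by move=> t' x' st; have [] := dw t' x' st.
- by move=> t' st; rewrite wE; exact: (C2_addZ (- e t') (C2uv _ st) C2psi).
- move=> t' x' /andP[st tT]; rewrite derive1E (@derive_val _ _ _ _ _ _ _ (dw t' x' st)).
  rewrite wE (operatorA_addZ Q b t' (- e t') x' (C2uv _ st) C2psi).
  rewrite ltrD2l mulN1r mulNr ltrN2 [k * _]mulrC -mulrA ltr_pM2l ?expR_gt0//.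
  by apply: psiA; rewrite st.
- by move=> x'; rewrite /w /e subrr mulr0 expR0 mul1r iniu iniv; have := fg x'; lra.
- move=> t' x' /andP[st tT] rx.
  have psix := rP x' (lt_le_trans rx (norm_le_enorm _)).
  have psi0 : 0 <= psi x' by apply: le_trans psix; rewrite divr_ge0// ltW.
  suff : N + N1 <= e t' * psi x'.
    have := uN (t', x') st; have := vN (t', x') st; rewrite /w /=.
    by rewrite !ler_norml => /andP[? ?] /andP[? ?] ?; lra.
  have <- : m * ((N + N1) / m) = N + N1 by rewrite mulrC divfK ?gt_eqF.
  apply: ler_pM => //.
  - exact: ltW.
  - by rewrite divr_ge0// ltW.
  rewrite ler_expR; have [k0|k0] := leP 0 k.
  - apply: (@le_trans _ _ 0); last by rewrite mulr_ge0// subr_ge0.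
    by rewrite mulNr oppr_le0 mulr_ge0// subr_ge0 (le_trans st).
  - by rewrite ltr0_norm// opprK ler_wnM2l ?lerB//; exact: ltW.
Qed.

(** A small multiple of a shifted Lyapunov function on the bounded interval [[s, t]] absorbs the
    behaviour at infinity, and then the multiple tends to 0. Used in both directions, this gives
    uniqueness of bounded solutions. *)
Lemma bounded_solution_le_mono (R : realType) (d : nat) (I : interval R)
    (Q : R -> 'rV[R]_d -> 'M[R]_d) (b : R -> 'rV[R]_d -> 'rV[R]_d)
    (s : R) (f g : 'rV[R]_d -> R) (u v : R -> 'rV[R]_d -> R) :
  (forall t, s <= t -> t \in I) -> uniformly_elliptic I Q ->
  lyapunov_condition I Q b ->
  bounded_classical_solution Q b s f u ->
  bounded_classical_solution Q b s g v ->
  (forall x, f x <= g x) ->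
  forall t x, s <= t -> u t x <= v t x.
Proof.
move=> sI ell lya su sv fg t x st.
have [||psi [lam [C2psi lam0 psioo psiA]]] := lya `[s, t].
- exact/compact_bounded/segment_compact.
- by move=> r /=; rewrite in_itv/= => /andP[sr _]; exact: sI.
have [r rP] := psioo 0.
(* The shift by [C] does two things: it makes [psi + C] positive, and it makes the inequality
   strict, since the operator kills constants while [lam * C > 0]. *)
have [C C0 psiC] : exists2 C, 0 < C & forall y, 0 < psi y + C.
  have [cpsi _ _ _] := C2psi.
  have /compact_bounded : compact (psi @` [set x | `|x| <= r]).
    by apply: continuous_compact (@compact_norm_le R d r); exact: continuous_subspaceT.
  move=> [M [_ /(_ (Num.max M 0 + 1))]].
  have MM : M < Num.max M 0 + 1 by rewrite ltr_pwDr// le_max lexx.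
  have M0 : 0 < Num.max M 0 + 1 by rewrite ltr_wpDl// le_max lexx orbT.
  move=> /(_ MM) Mb; exists (Num.max M 0 + 2); first lra.
  move=> y; have [yr|ry] := leP `|y| r.
    have := Mb (psi y); rewrite /= => /(_ _); rewrite ler_norml.
    have : (psi @` [set x | `|x| <= r]) (psi y) by exists y.
    move=> P /(_ P) /andP[? ?]; lra.
  have := rP y (lt_le_trans ry (norm_le_enorm _)); lra.
apply/ler_addgt0Pr => eps eps0.
pose K := expR (lam * (t - s)) * (psi x + C).
have K0 : 0 < K by rewrite mulr_gt0// expR_gt0.
(* With this factor the comparison function adds exactly [eps] at the given point [(t, x)]. *)
pose e := eps / K.
have e0 : 0 < e by rewrite divr_gt0.
pose Psi := (fun y => (fun=> e * C) y + e * psi y).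
have C2Psi : C2 Psi := C2_addZ e (@C2_cst R d (e * C)) C2psi.
have H := @bounded_solution_le R d I Q b s t lam f g Psi u v sI ell su sv C2Psi.
suff H' : u t x <= v t x + expR (lam * (t - s)) * Psi x.
  apply: le_trans H' _; rewrite lerD2l /Psi -mulrDr mulrCA [C + _]addrC -/K.
  by rewrite /e divfK// gt_eqF.
apply: H => [M|t' x' /andP[st' tt']|y|].
- have [r' r'P] := psioo (M / e - C); exists r' => y /r'P.
  by rewrite lerBlDr ler_pdivrMr// /Psi; lra.
- rewrite (operatorA_addZ Q b t' e x' (@C2_cst R d (e * C)) C2psi).
  rewrite operatorA_cst add0r.
  have t'st : t' \in `[s, t] by rewrite in_itv/= tt' ltW.
  have := psiA t' x' t'st; rewrite subr_le0 => psiA'.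
  apply: (@le_lt_trans _ _ (e * (lam * psi x'))); first by rewrite ler_pM2l.
  by rewrite /Psi; have := mulr_gt0 lam0 (mulr_gt0 e0 C0); lra.
- rewrite /Psi -mulrDr ler_wpDr// mulr_ge0// ltW// addrC; exact: psiC.
- by rewrite lexx st.
Qed.

Lemma bounded_solution_Cb (R : realType) (d : nat)
    (Q : R -> 'rV[R]_d -> 'M[R]_d) (b : R -> 'rV[R]_d -> 'rV[R]_d)
    (s t : R) (f : 'rV[R]_d -> R) (u : R -> 'rV[R]_d -> R) :
  bounded_classical_solution Q b s f u -> s <= t -> Cb (u t).
Proof.
move=> [cu /bounded_existsP[M M0 uM] _ _ _] st; split.
  exact: (continuous_within_slice cu (fun=> st)).
by apply/bounded_existsP; exists M => // x _; exact: (uM (t, x)).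
Qed.

Lemma bounded_solution_restart (R : realType) (d : nat)
    (Q : R -> 'rV[R]_d -> 'M[R]_d) (b : R -> 'rV[R]_d -> 'rV[R]_d)
    (s r : R) (f : 'rV[R]_d -> R) (u : R -> 'rV[R]_d -> R) :
  bounded_classical_solution Q b s f u -> s <= r ->
  bounded_classical_solution Q b r (u r) u.
Proof.
move=> [cu /bounded_existsP[M M0 uM] [cu1 du cdu cD cDD] equ _] sr.
have sub : [set z : R * 'rV[R]_d | r < z.1] `<=` [set z | s < z.1].
  by move=> z /=; exact: le_lt_trans.
split.
- by apply: continuous_subspaceW cu => z /=; exact: le_trans.
- apply/bounded_existsP; exists M => // z /= rz; apply: uM.
  exact: le_trans rz.
- split.
  + exact: continuous_subspaceW cu1.
  + by move=> t x rt; apply: du; exact: le_lt_trans rt.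
  + exact: continuous_subspaceW cdu.
  + by move=> i; exact: continuous_subspaceW (cD i).
  + by move=> i j; exact: continuous_subspaceW (cDD i j).
- by move=> t x rt; apply: equ; exact: le_lt_trans rt.
- by [].
Qed.

(** * Bounded continuous and bounded Borel functions *)

Lemma CbP (R : realType) (d : nat) (f : 'rV[R]_d -> R) :
  Cb f <-> continuous f /\ exists2 M, 0 < M & forall x, `|f x| <= M.
Proof.
split=> [[cf /bounded_existsP[M M0 fM]]|[cf [M M0 fM]]]; split=> //.
  by exists M => // x; exact: fM.
by apply/bounded_existsP; exists M => // x _; exact: fM.
Qed.

Lemma BbP (R : realType) (d : nat) (f : 'rV[R]_d -> R) :
  Bb f <-> measurable_fun [set: Borel R d] (f : Borel R d -> R) /\
    exists2 M, 0 < M & forall x, `|f x| <= M.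
Proof.
split=> [[cf /bounded_existsP[M M0 fM]]|[cf [M M0 fM]]]; split=> //.
  by exists M => // x; exact: fM.
by apply/bounded_existsP; exists M => // x _; exact: fM.
Qed.

Lemma Borel_measurable_continuous (R : realType) (d : nat) (f : 'rV[R]_d -> R) :
  continuous f -> measurable_fun [set: Borel R d] (f : Borel R d -> R).
Proof.
move=> /continuousP cf; apply: (measurability _ (RGenOpens.measurableE R)).
move=> _ [_ [a [b ->] <-]]; rewrite setTI; apply: sub_gen_smallest.
by apply: cf; exact: interval_open.
Qed.

Lemma Borel_measurable_open (R : realType) (d : nat) (U : set 'rV[R]_d) :
  open U -> measurable (U : set (Borel R d)).
Proof. by move=> oU; exact: sub_gen_smallest. Qed.

Lemma Cb_Bb (R : realType) (d : nat) (f : 'rV[R]_d -> R) : Cb f -> Bb f.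
Proof. by move=> [cf bf]; split => //; exact: Borel_measurable_continuous. Qed.

Lemma Cb_cst (R : realType) (d : nat) (k : R) : Cb (fun _ : 'rV[R]_d => k).
Proof.
apply/CbP; split; first exact: cst_continuous.
by exists (`|k| + 1); [rewrite ltr_wpDl|move=> x; rewrite lerDl].
Qed.

Lemma CbD (R : realType) (d : nat) (f g : 'rV[R]_d -> R) :
  Cb f -> Cb g -> Cb (fun x => f x + g x).
Proof.
move=> /CbP[cf [M M0 fM]] /CbP[cg [N N0 gN]]; apply/CbP; split.
  by move=> x; apply: (cvgD (cf x) (cg x)).
exists (M + N); first exact: addr_gt0.
by move=> x; rewrite (le_trans (ler_normD _ _))// lerD.
Qed.

Lemma CbM (R : realType) (d : nat) (f g : 'rV[R]_d -> R) :
  Cb f -> Cb g -> Cb (fun x => f x * g x).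
Proof.
move=> /CbP[cf [M M0 fM]] /CbP[cg [N N0 gN]]; apply/CbP; split.
  by move=> x; apply: (cvgM (cf x) (cg x)).
exists (M * N); first exact: mulr_gt0.
by move=> x; rewrite normrM ler_pM.
Qed.

Lemma CbZ (R : realType) (d : nat) (k : R) (f : 'rV[R]_d -> R) :
  Cb f -> Cb (fun x => k * f x).
Proof. by move=> Cf; apply: CbM => //; exact: Cb_cst. Qed.

Lemma CbB (R : realType) (d : nat) (f g : 'rV[R]_d -> R) :
  Cb f -> Cb g -> Cb (fun x => f x - g x).
Proof.
move=> Cf Cg; rewrite (_ : (fun x => _) = (fun x => f x + (- 1) * g x)).
  by apply: CbD => //; exact: CbZ.
by apply/funext => x; rewrite mulN1r.
Qed.

Lemma Cb_min (R : realType) (d : nat) (k : R) (f : 'rV[R]_d -> R) :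
  continuous f -> (forall x, 0 <= f x) -> Cb (fun x => Num.min (f x) k).
Proof.
move=> cf f0; apply/CbP; split.
  by move=> x; apply: continuous_min; [exact: cf|exact: cst_continuous].
exists (`|k| + 1); first by rewrite ltr_wpDl.
move=> x; rewrite ler_norml; apply/andP; split.
  have := f0 x; have := ler_norm (- k); rewrite normrN le_min => ? ?.
  by have := normr_ge0 k => ?; apply/andP; split; lra.
by rewrite ge_min; apply/orP; right; have := ler_norm k; lra.
Qed.

Lemma Cb_sum (R : realType) (d : nat) (f : nat -> 'rV[R]_d -> R) (n : nat) :
  (forall i, Cb (f i)) -> Cb (fun x => \sum_(i < n) f i x).
Proof.
move=> Cf; elim: n => [|n IH].
  rewrite (_ : (fun x => _) = (fun=> 0)); first exact: Cb_cst.
  by apply/funext => x; rewrite big_ord0.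
rewrite (_ : (fun x => _) = (fun x => (\sum_(i < n) f i x) + f n x)).
  exact: CbD.
by apply/funext => x; rewrite big_ord_recr.
Qed.

Lemma Bb_cst (R : realType) (d : nat) (k : R) : Bb (fun _ : 'rV[R]_d => k).
Proof. exact/Cb_Bb/Cb_cst. Qed.

Lemma BbD (R : realType) (d : nat) (f g : 'rV[R]_d -> R) :
  Bb f -> Bb g -> Bb (fun x => f x + g x).
Proof.
move=> /BbP[cf [M M0 fM]] /BbP[cg [N N0 gN]]; apply/BbP; split.
  exact: measurable_funD.
exists (M + N); first exact: addr_gt0.
by move=> x; rewrite (le_trans (ler_normD _ _))// lerD.
Qed.

Lemma Bb_integrable (R : realType) (d : nat) (P : probability (Borel R d) R)
    (f : 'rV[R]_d -> R) : Bb f -> P.-integrable setT (EFin \o f).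
Proof.
move=> [mf bf]; apply: measurable_bounded_integrable => //.
exact: (le_lt_trans (probability_le1 P measurableT) (ltry _)).
Qed.

Lemma Bb_EFin_Rintegral (R : realType) (d : nat) (P : probability (Borel R d) R)
    (f : 'rV[R]_d -> R) :
  Bb f -> (\int[P]_x (f x)%:E)%E = (\int[P]_x f x)%:E.
Proof.
by move=> Bf; rewrite /Rintegral fineK//; apply: integrable_fin_num => //; exact: Bb_integrable.
Qed.

Lemma Bb_RintegralD (R : realType) (d : nat) (P : probability (Borel R d) R)
    (f g : 'rV[R]_d -> R) : Bb f -> Bb g ->
  \int[P]_x (f x + g x) = \int[P]_x f x + \int[P]_x g x.
Proof. by move=> Bf Bg; rewrite RintegralD//; exact: Bb_integrable. Qed.

Lemma Bb_RintegralZ (R : realType) (d : nat) (P : probability (Borel R d) R)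
    (k : R) (f : 'rV[R]_d -> R) : Bb f ->
  \int[P]_x (k * f x) = k * \int[P]_x f x.
Proof. by move=> Bf; rewrite RintegralZl//; exact: Bb_integrable. Qed.

Lemma probability_Rintegral_cst (R : realType) (d : nat)
    (P : probability (Borel R d) R) (k : R) : \int[P]_x k = k.
Proof.
rewrite Rintegral_cst// -[RHS]mulr1; congr (_ * _).
by have /(congr1 (@fine R)) := probability_setT P.
Qed.

Lemma Bb_le_Rintegral (R : realType) (d : nat) (P : probability (Borel R d) R)
    (f g : 'rV[R]_d -> R) : Bb f -> Bb g -> (forall x, f x <= g x) ->
  \int[P]_x f x <= \int[P]_x g x.
Proof. by move=> Bf Bg fg; apply: le_Rintegral => //; exact: Bb_integrable. Qed.

Lemma nneseries_le_bound (R : realType) (u : nat -> \bar R) (B : \bar R) :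
  (forall n, (0 <= u n)%E) -> (forall n, (\sum_(0 <= i < n) u i <= B)%E) ->
  (\sum_(i <oo) u i <= B)%E.
Proof.
move=> u0 uB; apply: lime_le; first by apply: is_cvg_nneseries => n _ _; exact: u0.
by apply: nearW.
Qed.

(** The enumeration is chosen before the array, because one and the same [phi] must flatten both the
    values of the functional and the pointwise values of a double family of functions. *)
Lemma nneseries_pair (R : realType) : exists phi : nat -> nat * nat,
  forall a : nat -> nat -> \bar R, (forall i j, (0 <= a i j)%E) ->
    (\sum_(n <oo) a (phi n).1 (phi n).2 = \sum_(i <oo) \sum_(j <oo) a i j)%E.
Proof.
have /card_esym/card_set_bijP[f fbij] := card_nat2.
exists f => a a0.
rewrite nneseries_esumT// -(@reindex_esum _ _ _ _ _ f (fun k => a k.1 k.2) fbij).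
rewrite nneseries_esumT; last by move=> i; exact: nneseries_ge0.
under [RHS]eq_esum do rewrite nneseries_esumT//.
rewrite (@esum_esum _ _ _ setT (fun=> setT) a)//.
by congr (esum _ _); apply/seteqP; split.
Qed.

Lemma continuous_lip1 (R : realType) (V : normedModType R) (f : V -> R) :
  (forall x y, f x <= f y + `|x - y|) -> continuous f.
Proof.
move=> lip x; apply/cvgrPdist_lt => e e0.
apply/nbhs_ballP; exists e => //= y; rewrite -ball_normE/= => xy.
rewrite ltr_norml; have := lip x y; have := lip y x; rewrite (distrC y x).
by move=> ? ?; apply/andP; split; lra.
Qed.

(** [rho] is the distance to the complement of [U] cut off at 1, written as a supremum of radii so
    that [U] equal to the whole space is no exception. It is 1-Lipschitz and positive exactly on
    [U], so [Num.min (n%:R * rho x) 1] works. That the value 1 is attained lets a finite partial sum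
    cover a point of [U], and [u 0 = 0] starts the telescoping sums. *)
Lemma open_indic_approx (R : realType) (d : nat) (U : set 'rV[R]_d) :
  open U -> exists u : nat -> 'rV[R]_d -> R,
    [/\ (forall n, Cb (u n)),
        (forall n x, 0 <= u n x <= 1),
        (forall n x, u n x <= u n.+1 x),
        (forall n x, ~ U x -> u n x = 0) &
        u 0%N = (fun=> 0) /\ forall x, U x -> exists N, forall n, (N <= n)%N -> u n x = 1].
Proof.
move=> oU.
pose S x := [set r : R | 0 <= r <= 1 /\ forall y, `|x - y| < r -> U y].
have S0 x : S x 0.
  by split; [rewrite lexx ler01|move=> y; rewrite ltNge normr_ge0].
have ubS x : ubound (S x) 1 by move=> r [/andP[]].
have supS x : has_sup (S x) by split; [exists 0|exists 1].
pose rho x := sup (S x).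
have rho0 x : 0 <= rho x by apply: ub_le_sup => //; exists 1.
have rhoU x : ~ U x -> rho x = 0.
  move=> nUx; apply/eqP; rewrite eq_le rho0 andbT; apply: ge_sup; first by exists 0.
  move=> r [_ rU]; rewrite leNgt; apply/negP => r0; apply: nUx.
  by apply: rU; rewrite subrr normr0.
have Urho x : U x -> 0 < rho x.
  move=> Ux; have /nbhs_ballP[e/= e0 eU] := open_nbhs_nbhs (conj oU Ux).
  have m0 : 0 < Num.min e 1 by rewrite lt_min e0 ltr01.
  apply: (lt_le_trans m0); apply: ub_le_sup; first by exists 1.
  split; first by rewrite (ltW m0) ge_min lexx orbT.
  move=> y; rewrite lt_min => /andP[xy _]; apply: eU.
  by rewrite -ball_normE.
have lip x y : rho x <= rho y + `|x - y|.
  apply: ge_sup; first by exists 0.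
  move=> r [/andP[r0 r1] rU]; rewrite -lerBlDr.
  have [ry|/ltW ry] := leP (r - `|x - y|) 0; first exact: le_trans (rho0 y).
  apply: ub_le_sup; first by exists 1.
  split; first by rewrite ry/= (le_trans _ r1)// gerBl.
  move=> z yz; apply: rU; rewrite -(subrK y x) -addrA.
  rewrite (le_lt_trans (ler_normD _ _))//; lra.
have crho : continuous rho by exact: continuous_lip1.
exists (fun n x => Num.min (n%:R * rho x) 1); split.
- move=> n; apply: Cb_min => [x|x]; last by rewrite mulr_ge0.
  exact: (cvgMl_tmp (crho x)).
- by move=> n x; rewrite le_min ler01 mulr_ge0// ge_min lexx orbT.
- move=> n x; rewrite le_min !ge_min lexx !orbT andbT ler_wpM2r//.
  by rewrite ler_nat.
- by move=> n x nUx; rewrite rhoU// mulr0 min_l.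
- split; first by apply/funext => x; rewrite mul0r min_l.
  move=> x Ux; have r0 := Urho x Ux.
  exists (Num.bound (rho x)^-1) => n Nn; apply/min_idPr.
  rewrite -ler_pdivrMr// div1r (le_trans (ltW (archi_boundP _)))//.
    by rewrite invr_ge0 ltW.
  by rewrite ler_nat.
Qed.

(** * Daniell functionals *)

Definition Cb_pos (R : realType) (d : nat) (f : 'rV[R]_d -> R) : Prop :=
  Cb f /\ forall x, 0 <= f x.

(* Countable additivity is only needed for covers of the constant [1]: it is what
   makes the total mass of the outer measure equal to [1]. *)
Definition daniell_mean (R : realType) (d : nat) (L : ('rV[R]_d -> R) -> R) :
    Prop :=
  [/\ forall f g, Cb f -> Cb g -> L (fun x => f x + g x) = L f + L g,
      forall k f, Cb f -> L (fun x => k * f x) = k * L f,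
      forall f, Cb_pos f -> 0 <= L f,
      L (fun=> 1) = 1 &
      forall f : nat -> 'rV[R]_d -> R, (forall i, Cb_pos (f i)) ->
        (forall x, (1 <= \sum_(i <oo) (f i x)%:E)%E) ->
        (1 <= \sum_(i <oo) (L (f i))%:E)%E].

(** Daniell's upper integral. Covers are series instead of monotone limits, so that countable
    subadditivity is a rearrangement of double series; on indicators this is the outer measure to be
    constructed. *)
Definition upper_mean (R : realType) (d : nat) (L : ('rV[R]_d -> R) -> R)
    (h : 'rV[R]_d -> \bar R) : \bar R :=
  ereal_inf [set (\sum_(i <oo) (L (f i))%:E)%E | f in
    [set f : nat -> 'rV[R]_d -> R | (forall i, Cb_pos (f i)) /\
      forall x, (h x <= \sum_(i <oo) (f i x)%:E)%E]].

Lemma daniell_meanB (R : realType) (d : nat) (L : ('rV[R]_d -> R) -> R)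
    (f g : 'rV[R]_d -> R) :
  daniell_mean L -> Cb f -> Cb g -> L (fun x => f x - g x) = L f - L g.
Proof.
move=> [LD LZ _ _ _] Cf Cg; rewrite -mulN1r -LZ// -LD//; last exact: CbZ.
by congr L; apply/funext => x; rewrite mulN1r.
Qed.

Lemma daniell_mean0 (R : realType) (d : nat) (L : ('rV[R]_d -> R) -> R) :
  daniell_mean L -> L (fun=> 0) = 0.
Proof.
move=> [_ LZ _ _ _]; rewrite -[RHS](mul0r (L (fun=> 0))) -LZ; last exact: Cb_cst.
by congr L; apply/funext => x; rewrite mul0r.
Qed.

Lemma additive_Cb_sum (R : realType) (d : nat) (L : ('rV[R]_d -> R) -> R)
    (f : nat -> 'rV[R]_d -> R) (n : nat) :
  (forall f g, Cb f -> Cb g -> L (fun x => f x + g x) = L f + L g) ->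
  L (fun=> 0) = 0 -> (forall i, Cb (f i)) ->
  L (fun x => \sum_(i < n) f i x) = \sum_(i < n) L (f i).
Proof.
move=> LD L0 Cf; elim: n => [|n IH].
  by rewrite big_ord0 -[RHS]L0; congr L; apply/funext => x; exact: big_ord0.
rewrite big_ord_recr/= -IH -LD//; last exact: Cb_sum.
by congr L; apply/funext => x; rewrite big_ord_recr.
Qed.

Lemma daniell_mean_sum (R : realType) (d : nat) (L : ('rV[R]_d -> R) -> R)
    (f : nat -> 'rV[R]_d -> R) (n : nat) : daniell_mean L ->
  (forall i, Cb (f i)) ->
  L (fun x => \sum_(i < n) f i x) = \sum_(i < n) L (f i).
Proof.
move=> hL; apply: additive_Cb_sum; first by have [] := hL.
exact: daniell_mean0.
Qed.

Lemma upper_mean_ge0 (R : realType) (d : nat) (L : ('rV[R]_d -> R) -> R)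
    (h : 'rV[R]_d -> \bar R) : daniell_mean L -> (0 <= upper_mean L h)%E.
Proof.
move=> [_ _ L0 _ _]; apply: le_ereal_inf_tmp => _ [f [Cf _] <-].
by apply: nneseries_ge0 => i _ _; rewrite lee_fin L0.
Qed.

Lemma upper_mean_le (R : realType) (d : nat) (L : ('rV[R]_d -> R) -> R)
    (g h : 'rV[R]_d -> \bar R) :
  (forall x, (g x <= h x)%E) -> (upper_mean L g <= upper_mean L h)%E.
Proof.
move=> gh; apply: ereal_inf_le_tmp => _ [f [Cf hf] <-].
by exists f => //; split => // x; exact: le_trans (gh x) (hf x).
Qed.

Lemma upper_mean_Cb (R : realType) (d : nat) (L : ('rV[R]_d -> R) -> R)
    (f : 'rV[R]_d -> R) : daniell_mean L -> Cb_pos f ->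
  (upper_mean L (EFin \o f) <= (L f)%:E)%E.
Proof.
move=> hL Cf; pose g n : 'rV[R]_d -> R := if n is 0%N then f else fun=> 0.
have Cg i : Cb_pos (g i).
  by case: i => [//|i]; split=> //; exact: Cb_cst.
apply: ereal_inf_lbound; exists g.
  split => // x; apply: le_trans (nneseries_lim_ge 1 _).
    by rewrite big_nat1.
  by move=> n _ _; rewrite lee_fin; exact: (Cg n).2.
rewrite nneseries_recl//; last first.
  by move=> n _; have [_ _ L0 _ _] := hL; rewrite lee_fin; exact: L0.
rewrite eseries0 ?adde0//; case=> // n _ _.
by rewrite /= (daniell_mean0 hL).
Qed.

(** Near-optimal covers with errors [e / 2 ^ n.+1] are merged into one sequence. Pointwise
    domination is assumed instead of equality, which serves indicators of unions as well as sets
    covered by functions cut off by an indicator. *)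
Lemma upper_mean_subadditive (R : realType) (d : nat)
    (L : ('rV[R]_d -> R) -> R) (h : nat -> 'rV[R]_d -> \bar R)
    (g : 'rV[R]_d -> \bar R) : daniell_mean L ->
  (forall x, (g x <= \sum_(n <oo) h n x)%E) -> (forall n x, (0 <= h n x)%E) ->
  (upper_mean L g <= \sum_(n <oo) upper_mean L (h n))%E.
Proof.
move=> hL gh h0; have [[i ioo]|] := pselect (exists i, upper_mean L (h i) = +oo%E).
  rewrite (eseries_pinfty _ _ ioo) ?leey// => n _.
  by rewrite -ltNye (lt_le_trans _ (upper_mean_ge0 _ hL)).
rewrite -forallNE => Aoo.
suff add2e (e : {posnum R}) :
    (upper_mean L g <= \sum_(n <oo) upper_mean L (h n) + e%:num%:E)%E.
  by apply/lee_addgt0Pr => _/posnumP[].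
rewrite (le_trans _ (epsilon_trick _ _ _))//; last first.
  by move=> n; exact: upper_mean_ge0.
have /choice[G PG] : forall n, exists f : nat -> 'rV[R]_d -> R,
   [/\ (forall i, Cb_pos (f i)),
       (forall x, (h n x <= \sum_(i <oo) (f i x)%:E)%E) &
       (\sum_(i <oo) (L (f i))%:E <=
         upper_mean L (h n) + (e%:num / (2 ^ n.+1)%:R)%:E)%E].
  move=> n; have fin : upper_mean L (h n) \is a fin_num.
    rewrite ge0_fin_numE; last exact: upper_mean_ge0.
    by rewrite ltey; apply/eqP; exact: Aoo.
  have en1 : (0 < e%:num / (2 ^ n.+1)%:R)%R by [].
  have [_ [f [Cf hf] <-] /ltW fle] := lb_ereal_inf_adherent en1 fin.
  by exists f; split.
have [_ _ L0 _ _] := hL.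
have LG0 i j : (0 <= (L (G i j))%:E)%E by have [C _ _] := PG i; rewrite lee_fin L0.
have G0 i j x : (0 <= (G i j x)%:E)%E.
  by have [C _ _] := PG i; rewrite lee_fin; exact: (C j).2.
have [phi phiE] := nneseries_pair R.
apply: (@le_trans _ _ (\sum_(i <oo) \sum_(j <oo) (L (G i j))%:E)%E); last first.
  apply: lee_nneseries => [i _ _|i _]; first exact: nneseries_ge0.
  by have [] := PG i.
rewrite -(phiE _ LG0); apply: ereal_inf_lbound.
exists (fun n => G (phi n).1 (phi n).2) => //; split.
  by move=> n; have [] := PG (phi n).1.
move=> x; rewrite (phiE (fun i j => (G i j x)%:E))//.
apply: le_trans (gh x) _; apply: lee_nneseries => [i _ _|i _]; first exact: h0.
by have [] := PG i.
Qed.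

(* [f * \1_U] is the sum of the telescoping series [f * (u m.+1 - u m)], whose
   partial sums leave [f * (1 - u n)] as a bound for [f * \1_(~` U)]. *)
Lemma upper_mean_split (R : realType) (d : nat) (L : ('rV[R]_d -> R) -> R)
    (f : 'rV[R]_d -> R) (U : set 'rV[R]_d) :
  daniell_mean L -> Cb_pos f -> open U ->
  (upper_mean L (fun x => (f x * \1_U x)%:E) +
   upper_mean L (fun x => (f x * \1_(~` U) x)%:E) <= (L f)%:E)%E.
Proof.
move=> hL [Cf f0] oU; have [u [Cu u01 umono uU [u0 u1]]] := open_indic_approx oU.
set w := upper_mean L (fun x => (f x * \1_(~` U) x)%:E).
have wle n : (w <= (L f - L (fun x => f x * u n x))%:E)%E.
  rewrite -daniell_meanB//; last exact: CbM.
  have Cp : Cb_pos (fun x => f x - f x * u n x).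
    split=> [|x]; first by apply: CbB => //; exact: CbM.
    by rewrite subr_ge0 ler_piMr//; have /andP[] := u01 n x.
  apply: le_trans (upper_mean_Cb hL Cp); apply: upper_mean_le => x.
  rewrite lee_fin indicE; have [Ux|nUx] := pselect (U x).
    by rewrite memNset ?mulr0; [exact: Cp.2|move=> /(_ Ux)].
  by rewrite mem_set// mulr1 uU// mulr0 subr0.
have wfin : w \is a fin_num.
  rewrite ge0_fin_numE; last exact: upper_mean_ge0.
  exact: le_lt_trans (wle 0%N) (ltry _).
rewrite -(fineK wfin); set r := fine w.
have rle n : L (fun x => f x * u n x) <= L f - r.
  by have := wle n; rewrite -(fineK wfin) lee_fin -/r; lra.
rewrite -leeBrDr//.
pose v m x := f x * (u m.+1 x - u m x).
have Cv m : Cb_pos (v m).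
  split=> [|x]; first by apply: CbM => //; exact: CbB.
  by rewrite mulr_ge0// subr_ge0.
have sumv n x : \sum_(m < n) v m x = f x * u n x.
  elim: n => [|n IH]; first by rewrite big_ord0 u0 mulr0.
  by rewrite big_ord_recr/= IH -mulrDr addrC subrK.
apply: (@le_trans _ _ (\sum_(m <oo) (L (v m))%:E)%E).
  apply: ereal_inf_lbound; exists v => //; split=> // x.
  have [Ux|nUx] := pselect (U x); last first.
    rewrite indicE memNset// mulr0; apply: nneseries_ge0 => m _ _.
    by rewrite lee_fin; exact: (Cv m).2.
  rewrite indicE mem_set// mulr1; have [N /(_ N (leqnn N)) uN] := u1 x Ux.
  apply: le_trans (nneseries_lim_ge N _); last first.
    by move=> m _ _; rewrite lee_fin; exact: (Cv m).2.
  by rewrite big_mkord sumEFin sumv uN mulr1.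
apply: nneseries_le_bound => [m|n].
  by have [_ _ L0 _ _] := hL; rewrite lee_fin L0.
rewrite big_mkord sumEFin -daniell_mean_sum//; last by move=> i; exact: (Cv i).1.
rewrite -EFinB lee_fin; apply: le_trans (rle n).
by rewrite le_eqVlt; apply/orP; left; apply/eqP; congr L; apply/funext => x.
Qed.

(** Each member of a cover of [A] is split along [U]; the two families of pieces bound the upper
    means of [A] inside and outside [U], and by [upper_mean_split] the splitting costs nothing. *)
Lemma upper_mean_open_caratheodory (R : realType) (d : nat)
    (L : ('rV[R]_d -> R) -> R) (U A : set 'rV[R]_d) :
  daniell_mean L -> open U ->
  (upper_mean L (EFin \o \1_(A `&` U)) + upper_mean L (EFin \o \1_(A `&` ~` U))
    <= upper_mean L (EFin \o \1_A))%E.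
Proof.
move=> hL oU; apply: le_ereal_inf_tmp => _ [f [Cf Af] <-].
have f0 i x : 0 <= f i x by exact: (Cf i).2.
have sub B : (upper_mean L (EFin \o \1_(A `&` B)) <=
    \sum_(i <oo) upper_mean L (fun x => (f i x * \1_B x)%:E))%E.
  apply: upper_mean_subadditive => // [x|n x]; last first.
    by rewrite lee_fin mulr_ge0.
  rewrite /= indicI/=; have [Bx|nBx] := pselect (B x).
    rewrite [\1_B x]indicE mem_set// mulr1.
    by apply: le_trans (Af x) _; apply: lee_nneseries => [i _ _|i _]; rewrite ?mulr1 ?lee_fin.
  rewrite [\1_B x]indicE memNset// mulr0.
  by apply: nneseries_ge0 => i _ _; rewrite mulr0 lee_fin.
apply: (@le_trans _ _ (\sum_(i <oo) (upper_mean L (fun x => (f i x * \1_U x)%:E)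
    + upper_mean L (fun x => (f i x * \1_(~` U) x)%:E)))%E).
  rewrite nneseriesD; [|by move=> *; exact: upper_mean_ge0..].
  by apply: leeD; exact: sub.
apply: lee_nneseries => [i _ _|i _].
  by apply: adde_ge0; exact: upper_mean_ge0.
exact: upper_mean_split.
Qed.

Lemma daniell_measure (R : realType) (d : nat) (L : ('rV[R]_d -> R) -> R) :
  daniell_mean L -> exists P : probability (Borel R d) R,
    forall A : set 'rV[R]_d, P A = upper_mean L (EFin \o \1_A).
Proof.
move=> hL; pose muS (A : set 'rV[R]_d) : \bar R := upper_mean L (EFin \o \1_A).
have mu_ge0 A : (0 <= muS A)%E by exact: upper_mean_ge0.
have mu0 : muS set0 = 0%E.
  apply/eqP; rewrite eq_le mu_ge0 andbT.
  have C0 : Cb_pos (fun _ : 'rV[R]_d => 0 : R) by split; [exact: Cb_cst|].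
  have := upper_mean_Cb hL C0; rewrite (daniell_mean0 hL); apply: le_trans.
  by apply: upper_mean_le => x; rewrite /= indic0.
have mu_le : {homo muS : A B / A `<=` B >-> (A <= B)%E}.
  move=> A B AB; apply: upper_mean_le => x; rewrite lee_fin !indicE ler_nat.
  by case: (boolP (x \in A)) => // /set_mem/AB/mem_set ->.
have mu_sub : sigma_subadditive muS.
  move=> F; apply: upper_mean_subadditive => //; last first.
    by move=> n x; rewrite lee_fin.
  move=> x; have F0 n : (0 <= (EFin \o \1_(F n)) x)%E by rewrite lee_fin.
  have [[n _ Fx]|nF] := pselect ((\bigcup_n F n) x); last first.
    by rewrite /= indicE memNset//; exact: nneseries_ge0.
  apply: (@le_trans _ _ (\sum_(0 <= i < n.+1) (EFin \o \1_(F i)) x)%E); last first.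
    by apply: nneseries_lim_ge => k _ _; exact: F0.
  rewrite big_nat_recr//= !indicE (mem_set Fx) mem_set; last by exists n.
  by rewrite leeDr// sume_ge0.
pose m := isOuterMeasure.Build R _ muS mu0 mu_ge0 mu_le mu_sub.
pose mu : {outer_measure set 'rV[R]_d -> \bar R} := HB.pack muS m.
have bor (A : set (Borel R d)) : measurable A -> mu.-caratheodory A.
  apply: smallest_sub.
    split.
    - exact: caratheodory_measurable_set0.
    - by move=> B; rewrite setTD; exact: caratheodory_measurable_setC.
    - exact: caratheodory_measurable_bigcup.
  move=> U oU; apply: le_caratheodory_measurable => B.
  exact: upper_mean_open_caratheodory.
pose P0 : set (Borel R d) -> \bar R := muS.
have P_ge0 A : (0 <= P0 A)%E by exact: mu_ge0.
have P_add : semi_sigma_additive P0.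
  move=> F mF tF mUF; apply: (@caratheodory_measure_sigma_additive _ _ mu) => //.
  - by move=> i; exact: (bor _ (mF i)).
  - exact: bor.
pose pm := isMeasure.Build _ (Borel R d) R P0 mu0 P_ge0 P_add.
have P1 : P0 setT = 1%E.
  have [_ _ _ L1 Ls] := hL; apply/eqP; rewrite eq_le; apply/andP; split.
    have C1 : Cb_pos (fun _ : 'rV[R]_d => 1 : R) by split; [exact: Cb_cst|].
    have := upper_mean_Cb hL C1; rewrite L1; apply: le_trans.
    by apply: upper_mean_le => x; rewrite /= indicT.
  apply: le_ereal_inf_tmp => _ [f [Cf f1] <-]; apply: Ls => // x.
  by have := f1 x; rewrite /= indicT.
pose pmeas : {measure set (Borel R d) -> \bar R} := HB.pack P0 pm.
pose pp := Measure_isProbability.Build _ _ R pmeas P1.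
pose P : probability (Borel R d) R := HB.pack P0 pm pp.
by exists P.
Qed.

Lemma Cb_Rintegral_sum (R : realType) (d : nat) (P : probability (Borel R d) R)
    (f : nat -> 'rV[R]_d -> R) (n : nat) : (forall i, Cb (f i)) ->
  \int[P]_x (\sum_(i < n) f i x) = \sum_(i < n) \int[P]_x f i x.
Proof.
move=> Cf; elim: n => [|n IH].
  rewrite big_ord0 -[RHS](probability_Rintegral_cst P 0).
  by apply: eq_Rintegral => x _; exact: big_ord0.
rewrite big_ord_recr/= -IH -Bb_RintegralD; last 2 first.
- exact/Cb_Bb/Cb_sum.
- exact/Cb_Bb.
by apply: eq_Rintegral => x _; exact: big_ord_recr.
Qed.

Lemma Rintegral_le_fine (R : realType) (d : nat) (P : probability (Borel R d) R)
    (f : 'rV[R]_d -> R) (A : set (Borel R d)) :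
  measurable A -> Bb f -> (forall x, f x <= \1_A x) ->
  \int[P]_x f x <= fine (P A).
Proof.
move=> mA Bf fA; have BA : Bb (\1_A : 'rV[R]_d -> R).
  apply/BbP; split; first exact: measurable_indic.
  by exists 1 => // x; rewrite indicE; case: (_ \in _); rewrite ?normr1 ?normr0.
rewrite (le_trans (Bb_le_Rintegral P Bf BA fA))// /Rintegral.
by rewrite integral_indic// setIT.
Qed.

(* Layer cake: [g] is the sum of the slices [min g k.+1 - min g k], which lie
   between the indicators of [g > k.+1] and of [g > k]. *)
Lemma daniell_Rintegral_le1 (R : realType) (d : nat)
    (L : ('rV[R]_d -> R) -> R) (P : probability (Borel R d) R)
    (g : 'rV[R]_d -> R) :
  daniell_mean L ->
  (forall A : set 'rV[R]_d, P A = upper_mean L (EFin \o \1_A)) ->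
  Cb_pos g -> \int[P]_x g x <= 1 + L g.
Proof.
move=> hL PE [Cg g0]; have [cg [M M0 gM]] := (CbP g).1 Cg.
pose n := Num.bound M.
have gn x : g x <= n%:R.
  rewrite (le_trans (ler_norm _))// (le_trans (gM x))// ltW// archi_boundP//.
  exact: ltW.
pose h k x := Num.min (g x) k.+1%:R - Num.min (g x) k%:R.
have Ch k : Cb (h k) by apply: CbB; exact: Cb_min.
have gE : g = (fun x => \sum_(k < n) h k x).
  apply/funext => x; transitivity (Num.min (g x) n%:R - Num.min (g x) 0%:R).
    by rewrite min_l// min_r// subr0.
  elim: (n) => [|m IH]; first by rewrite subrr big_ord0.
  by rewrite big_ord_recr/= -IH /h; lra.
have hle1 k x : h k x <= 1.
  rewrite /h lerBlDr -natr1; have [gk|gk] := leP (g x) k%:R.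
    by rewrite ge_min; apply/orP; left; lra.
  by rewrite ge_min; apply/orP; right; lra.
have h0 k x : 0 <= h k x.
  by rewrite /h subr_ge0 le_min ge_min lexx/= ge_min ler_nat leqnSn orbT.
pose E k : set (Borel R d) := [set x : 'rV[R]_d | k%:R < g x].
have mE k : measurable (E k).
  apply: Borel_measurable_open.
  apply: (@open_comp _ _ g [set r | k%:R < r]); last exact: open_gt.
  by move=> x _; exact: cg.
have hE k x : h k x <= \1_(E k) x.
  rewrite indicE; have [gk|gk] := leP (g x) k%:R.
    rewrite memNset/=; last by rewrite /E/= ltNge gk.
    by rewrite /h !min_l ?subrr// (le_trans gk)// ler_nat.
  by rewrite mem_set//=; exact: hle1.
have Eh k : fine (P (E k.+1)) <= L (h k).
  rewrite -lee_fin fineK; last exact: fin_num_measure.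
  rewrite PE; apply: (@le_trans _ _ (upper_mean L (EFin \o h k))); last first.
    by apply: upper_mean_Cb => //; split.
  apply: upper_mean_le => x; rewrite lee_fin indicE.
  have [/set_mem/= gk|] := boolP (x \in _); last by rewrite h0.
  rewrite /h !min_r ?(ltW gk)//.
    by rewrite -natr1; lra.
  by rewrite (le_trans _ (ltW gk))// ler_nat.
have E1 k : 0 <= fine (P (E k)) <= 1.
  rewrite fine_ge0//= -[leRHS]/(fine 1%:E) fine_le//.
    exact: fin_num_measure.
  exact: probability_le1.
rewrite {1}gE Cb_Rintegral_sum// [X in 1 + L X]gE daniell_mean_sum//.
apply: (@le_trans _ _ (\sum_(k < n) fine (P (E k)))).
  by apply: ler_sum => k _; apply: Rintegral_le_fine => //; exact: Cb_Bb.
(* Shifting the index by one costs at most [P (E 0)], hence at most 1: this is the origin of the 1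
   in the bound. *)
apply: (@le_trans _ _ (1 + \sum_(k < n) fine (P (E k.+1)))); last first.
  by rewrite lerD2l; apply: ler_sum => k _.
have : \sum_(k < n.+1) fine (P (E k)) = \sum_(k < n) fine (P (E k)) + fine (P (E n)).
  by rewrite big_ord_recr.
rewrite big_ord_recl/= => sE.
have := E1 0%N; have := E1 n; move: sE; lra.
Qed.

(** The error 1 in the previous bound does not depend on the function: applied to [e^-1 * f], the
    bound has error [e] for [f]. *)
Lemma daniell_Rintegral_le (R : realType) (d : nat)
    (L : ('rV[R]_d -> R) -> R) (P : probability (Borel R d) R)
    (f : 'rV[R]_d -> R) :
  daniell_mean L ->
  (forall A : set 'rV[R]_d, P A = upper_mean L (EFin \o \1_A)) ->
  Cb_pos f -> \int[P]_x f x <= L f.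
Proof.
move=> hL PE [Cf f0]; apply/ler_addgt0Pr => e e0.
have Cef : Cb_pos (fun x => e^-1 * f x).
  by split=> [|x]; [exact: CbZ|rewrite mulr_ge0// invr_ge0 ltW].
have := daniell_Rintegral_le1 hL PE Cef.
rewrite Bb_RintegralZ; last exact: Cb_Bb.
have [_ -> // _ _ _] := hL.
by rewrite addrC -(ler_pM2l e0) mulrDr mulr1 !mulVKf ?gt_eqF.
Qed.

(** With [M] a bound of [|f|], the one-sided inequality for [M + f] and for [M - f] gives both
    inequalities, since [L] and the integral agree on the constant [M]. *)
Lemma daniell_representation (R : realType) (d : nat)
    (L : ('rV[R]_d -> R) -> R) :
  daniell_mean L -> exists P : probability (Borel R d) R,
    forall f, Cb f -> \int[P]_x f x = L f.
Proof.
move=> hL; have [P PE] := daniell_measure hL; exists P => f Cf.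
have [cf [M M0 fM]] := (CbP f).1 Cf.
have LM k : L (fun=> k) = k.
  have [_ LZ _ L1 _] := hL; rewrite -[RHS]mulr1 -L1 -LZ; last exact: Cb_cst.
  by congr L; apply/funext => x; rewrite mulr1.
have [LD _ _ _ _] := hL.
have CM : Cb (fun _ : 'rV[R]_d => M) by exact: Cb_cst.
have Cp : Cb_pos (fun x => M + f x).
  by split=> [|x]; [exact: CbD|have := fM x; rewrite ler_norml; lra].
have Cm : Cb_pos (fun x => M - f x).
  by split=> [|x]; [exact: CbB|have := fM x; rewrite ler_norml; lra].
have := daniell_Rintegral_le hL PE Cp; have := daniell_Rintegral_le hL PE Cm.
rewrite (LD _ _ CM Cf) (daniell_meanB hL CM Cf) LM.
rewrite (Bb_RintegralD P (Cb_Bb CM) (Cb_Bb Cf)).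
have iM := Bb_integrable P (Cb_Bb CM); have iF := Bb_integrable P (Cb_Bb Cf).
rewrite (RintegralB measurableT iM iF).
rewrite probability_Rintegral_cst => ? ?; lra.
Qed.

(** * From bounded continuous to bounded Borel functions *)

Lemma measure_open_cvg (R : realType) (d : nat)
    (m : {measure set (Borel R d) -> \bar R}) (U : set 'rV[R]_d)
    (u : nat -> 'rV[R]_d -> R) :
  open U -> (forall n, Cb (u n)) -> (forall n x, 0 <= u n x <= 1) ->
  (forall n x, u n x <= u n.+1 x) -> (forall n x, ~ U x -> u n x = 0) ->
  (forall x, U x -> exists N, forall n, (N <= n)%N -> u n x = 1) ->
  (\int[m]_x (u n x)%:E)%E @[n --> \oo] --> m U.
Proof.
move=> oU Cu u01 umono uU u1.
have mU : measurable (U : set (Borel R d)) by exact: Borel_measurable_open.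
rewrite -[X in m X]setIT -integral_indic//.
have uE (x : Borel R d) : setT x -> (u n x)%:E @[n --> \oo] --> (\1_U x)%:E.
  move=> _; rewrite indicE; have [Ux|nUx] := pselect (U x).
    have [N uN] := u1 x Ux; rewrite mem_set//.
    apply: cvg_near_cst; exists N => // n /= Nn; by rewrite uN.
  rewrite memNset//; apply: cvg_near_cst; apply: nearW => n; by rewrite uU.
rewrite (_ : (\int[m]_x (\1_U x)%:E)%E =
    (\int[m]_x limn (fun n => (u n x)%:E))%E); last first.
  by apply: eq_integral => x _; apply/esym/cvg_lim => //; exact: uE.
apply: (@cvg_monotone_convergence _ (Borel R d) R m setT measurableT
  (fun n x => (u n x)%:E)) => //.
- by move=> n; apply/measurable_EFinP; have [] := Cb_Bb (Cu n).
- by move=> n x _; rewrite lee_fin; have /andP[] := u01 n x.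
- move=> x _; apply/nondecreasing_seqP => n; rewrite lee_fin; exact: umono.
Qed.

(** Dynkin's lemma on the open sets: for open [U] the map is a pointwise limit of integrals of
    continuous functions, which are continuous in [x] by hypothesis. *)
Lemma measurable_probability_family (R : realType) (d : nat)
    (kap : 'rV[R]_d -> probability (Borel R d) R) :
  (forall f, Cb f -> Cb (fun x => \int[kap x]_y f y)) ->
  forall A : set (Borel R d), measurable A ->
    measurable_fun [set: Borel R d] (fun x : Borel R d => kap x A).
Proof.
move=> Ck; apply: (@dynkin_induction _ (Borel R d) (@open 'rV[R]_d)) => //.
- by move=> U V oU oV; exact: openI.
- rewrite (_ : (fun x => _) = cst 1%E); first exact: measurable_cst.
  by apply/funext => x; exact: probability_setT.
- move=> U oU; have [u [Cu u01 umono uU [u0 u1]]] := open_indic_approx oU.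
  apply: (@emeasurable_fun_cvg _ (Borel R d) R setT
      (fun n (x : Borel R d) => (\int[kap x]_y (u n y)%:E)%E)).
    move=> n; rewrite (_ : (fun x => _) = (fun x => (\int[kap x]_y u n y)%:E)).
      by apply/measurable_EFinP; have [] := Cb_Bb (Ck _ (Cu n)).
    by apply/funext => x; rewrite Bb_EFin_Rintegral//; exact: Cb_Bb.
  by move=> x _; exact: measure_open_cvg.
- move=> S mS mkS.
  rewrite (_ : (fun x => _) = (fun x : Borel R d => 1 - kap x S)%E).
    by apply: emeasurable_funB => //; exact: measurable_cst.
  by apply/funext => x; rewrite probability_setC.
- move=> F mF tF mkF.
  rewrite (_ : (fun x => _) = (fun x : Borel R d => \sum_(n <oo) kap x (F n))%E).
    by apply: ge0_emeasurable_sum => //.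
  apply/funext => x; apply/esym/cvg_lim => //.
  by apply: measure_semi_sigma_additive => //; exact: bigcup_measurable.
Qed.

(** The mixture [m] of the measures [kap x] under [P] agrees with [P'] on open sets, by
    approximating their indicators from below in [Cb]; so the two measures coincide, and so do their
    integrals of bounded Borel functions. *)
Lemma integral_compose_Bb (R : realType) (d : nat)
    (kap : 'rV[R]_d -> probability (Borel R d) R)
    (P P' : probability (Borel R d) R) :
  (forall f, Cb f -> Cb (fun x => \int[kap x]_y f y)) ->
  (forall f, Cb f -> \int[P]_x (\int[kap x]_y f y) = \int[P']_x f x) ->
  forall f, Bb f ->
    (\int[P]_x (\int[kap x]_y f y)%:E = \int[P']_x (f x)%:E)%E.
Proof.
move=> Ck PP' f Bf.
have mk := measurable_probability_family Ck.
have mkap : measurable_fun [set: Borel R d]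
    ((fun x => kap x) : Borel R d -> giry (Borel R d) R).
  by apply: measurable_giry_codensity => // B mB; exact: mk.
pose m := giry_bind (P : giry (Borel R d) R) mkap.
have mE (h : Borel R d -> \bar R) : measurable_fun setT h ->
    (forall x, (0 <= h x)%E) ->
    (\int[m]_x h x = \int[P]_x \int[kap x]_y h y)%E.
  by move=> mh h0; exact: giry_int_bind.
have mP' (A : set (Borel R d)) : measurable A -> m A = P' A.
  apply: (@g_sigma_algebra_measure_unique _ R (Borel R d) (@open 'rV[R]_d) _ (fun=> setT)).
  - by move=> U oU; exact: Borel_measurable_open.
  - by move=> _; exact: openT.
  - by apply/seteqP; split => // x _; exists 0%N.
  - by move=> U V oU oV; exact: openI.
  - move=> U oU; have [u [Cu u01 umono uU [u0 u1]]] := open_indic_approx oU.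
    have H1 := @measure_open_cvg R d m U u oU Cu u01 umono uU u1.
    have H2 := @measure_open_cvg R d P' U u oU Cu u01 umono uU u1.
    rewrite -(cvg_lim _ H1)// -(cvg_lim _ H2)//; apply/congr_lim/funext => n.
    rewrite mE.
    + rewrite Bb_EFin_Rintegral; last exact: Cb_Bb.
      rewrite -PP'// -Bb_EFin_Rintegral; last exact/Cb_Bb/Ck.
      apply: eq_integral => x _; rewrite Bb_EFin_Rintegral//; exact: Cb_Bb.
    + by apply/measurable_EFinP; have [] := Cb_Bb (Cu n).
    + by move=> x; rewrite lee_fin; have /andP[] := u01 n x.
  - move=> _; apply: le_lt_trans (ltry 1); exact: sprobability_setT.
have [mf [M M0 fM]] := (BbP f).1 Bf.
(* The formula [mE] for integration against the mixture concerns nonnegative functions, so [f] is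
   shifted by its bound and the constant is removed at the end. *)
pose g x := M + f x.
have Bg : Bb g by apply: BbD => //; exact: Bb_cst.
have g0 x : 0 <= g x by have := fM x; rewrite ler_norml /g; lra.
have [mg _] := Bg.
have gE x : \int[kap x]_y g y = M + \int[kap x]_y f y.
  by rewrite (Bb_RintegralD _ (Bb_cst d M) Bf) probability_Rintegral_cst.
have BH : Bb (fun x => \int[kap x]_y g y).
  apply/BbP; split.
    apply/measurable_EFinP.
    rewrite (_ : _ \o _ = (fun x : Borel R d => \int[kap x]_y (g y)%:E)%E).
      apply: (@measurable_fun_integral_kernel _ _ (Borel R d) (Borel R d) R
        (fun x => kap x)) => //; exact/measurable_EFinP.
    by apply/funext => x; rewrite Bb_EFin_Rintegral.
  exists (M + M); first exact: addr_gt0.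
  move=> x; rewrite ger0_norm; last first.
    rewrite -(probability_Rintegral_cst (kap x) 0).
    by apply: Bb_le_Rintegral => //; exact: Bb_cst.
  rewrite -(probability_Rintegral_cst (kap x) (M + M)).
  apply: Bb_le_Rintegral => //; first exact: Bb_cst.
  by move=> y; have := fM y; rewrite ler_norml /g; lra.
have : \int[P]_x (\int[kap x]_y g y) = \int[P']_x g x.
  apply: EFin_inj; rewrite -!Bb_EFin_Rintegral//.
  transitivity (\int[m]_x (g x)%:E)%E.
    rewrite mE//; last exact/measurable_EFinP.
    by apply: eq_integral => x _; rewrite Bb_EFin_Rintegral.
  by apply: eq_measure_integral => A mA _; exact: mP'.
have BHf : Bb (fun x => \int[kap x]_y f y).
  rewrite (_ : (fun x => _) = (fun x => \int[kap x]_y g y + (- M))).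
    by apply: BbD => //; exact: Bb_cst.
  by apply/funext => x; rewrite gE; lra.
rewrite !Bb_EFin_Rintegral//; move=> H; congr EFin; move: H.
rewrite (_ : (fun x => \int[kap x]_y g y) = (fun x => M + \int[kap x]_y f y)); last first.
  exact/funext.
rewrite (Bb_RintegralD _ (Bb_cst d M) BHf) (Bb_RintegralD _ (Bb_cst d M) Bf).
by rewrite !probability_Rintegral_cst => /addrI.
Qed.

(** * The evolution operator *)

Lemma halfline_up (R : realType) (I : interval R) (s t : R) :
  line_or_right_halfline I -> s \in I -> s <= t -> t \in I.
Proof.
move=> [->|[r [->|->]]]; rewrite !in_itv/= ?andbT//.
- exact: lt_le_trans.
- exact: le_trans.
Qed.

Lemma evolution_Rintegral (R : realType) (d : nat) (I : interval R)
    (Q : R -> 'rV[R]_d -> 'M[R]_d) (b : R -> 'rV[R]_d -> 'rV[R]_d)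
    (p : R -> R -> 'rV[R]_d -> probability (Borel R d) R)
    (G : R -> R -> ('rV[R]_d -> R) -> 'rV[R]_d -> R)
    (s t : R) (f : 'rV[R]_d -> R) :
  evolution_operator I Q b p G -> s \in I -> s <= t -> Bb f ->
  G t s f = (fun x => \int[p t s x]_y f y).
Proof.
move=> [_ hG] sI st Bf; apply/funext => x; apply: EFin_inj.
by rewrite hG// Bb_EFin_Rintegral.
Qed.

Lemma evolution_Cb (R : realType) (d : nat) (I : interval R)
    (Q : R -> 'rV[R]_d -> 'M[R]_d) (b : R -> 'rV[R]_d -> 'rV[R]_d)
    (p : R -> R -> 'rV[R]_d -> probability (Borel R d) R)
    (G : R -> R -> ('rV[R]_d -> R) -> 'rV[R]_d -> R)
    (s t : R) (f : 'rV[R]_d -> R) :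
  evolution_operator I Q b p G -> s \in I -> s <= t -> Cb f -> Cb (G t s f).
Proof.
by move=> [hG _] sI st Cf; exact: (bounded_solution_Cb (hG _ _ sI Cf) st).
Qed.

Lemma evolution_law (R : realType) (d : nat) (I : interval R)
    (Q : R -> 'rV[R]_d -> 'M[R]_d) (b : R -> 'rV[R]_d -> 'rV[R]_d)
    (p : R -> R -> 'rV[R]_d -> probability (Borel R d) R)
    (G : R -> R -> ('rV[R]_d -> R) -> 'rV[R]_d -> R)
    (s r t : R) (f : 'rV[R]_d -> R) :
  line_or_right_halfline I -> uniformly_elliptic I Q ->
  lyapunov_condition I Q b -> evolution_operator I Q b p G ->
  s \in I -> s <= r -> r <= t -> Cb f -> G t r (G r s f) = G t s f.
Proof.
move=> hI ell lya hG sI sr rt Cf; apply/funext => x.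
have rI : r \in I := halfline_up hI sI sr.
have rup t' : r <= t' -> t' \in I by exact: halfline_up.
have Cg := evolution_Cb hG sI sr Cf.
have s1 := (hG.1 _ _ rI Cg).
have s2 := bounded_solution_restart (hG.1 _ _ sI Cf) sr.
by apply/eqP; rewrite eq_le; apply/andP; split;
  [apply: (bounded_solution_le_mono rup ell lya s1 s2)|
   apply: (bounded_solution_le_mono rup ell lya s2 s1)].
Qed.

(* With the constant [2 * a / c] in place of [a / c] the function
   [phi - 2 * a / c] is a strict supersolution. *)
Lemma evolution_lyapunov_le (R : realType) (d : nat) (I : interval R)
    (Q : R -> 'rV[R]_d -> 'M[R]_d) (b : R -> 'rV[R]_d -> 'rV[R]_d)
    (p : R -> R -> 'rV[R]_d -> probability (Borel R d) R)
    (G : R -> R -> ('rV[R]_d -> R) -> 'rV[R]_d -> R)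
    (phi : 'rV[R]_d -> R) (a c t0 s t N : R) (x : 'rV[R]_d) :
  line_or_right_halfline I -> uniformly_elliptic I Q ->
  evolution_operator I Q b p G ->
  C2 phi -> (forall x, 0 <= phi x) -> tends_to_infinity phi ->
  0 < a -> 0 < c ->
  (forall t x, t0 <= t -> operatorA Q b t phi x <= a - c * phi x) ->
  s \in I -> t0 <= s -> s <= t ->
  G t s (fun y => Num.min (phi y) N) x <= phi x + 2 * a / c.
Proof.
move=> hI ell hG C2phi phi0 phioo a0 c0 phiA sI t0s st.
have sup t' : s <= t' -> t' \in I by exact: halfline_up.
set K := 2 * a / c; have K0 : 0 < K by rewrite divr_gt0 ?mulr_gt0.
have CN : Cb (fun y => Num.min (phi y) N).
  by apply: Cb_min => //; have [] := C2phi.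
have CK := @Cb_cst R d K.
have C2psi := C2_addZ 1 (@C2_cst R d (- K)) C2phi.
have psioo : tends_to_infinity (fun y => - K + 1 * phi y).
  by move=> M; have [r rP] := phioo (M + K); exists r => y /rP ?; lra.
(* The second solution is [G] applied to the constant [K], which stays [K]. The comparison yields
   [K + e * (phi x - K)] with [0 < e <= 1], and this is at most [phi x + K]. *)
have := @bounded_solution_le R d I Q b s t (- c) _ _ _ _ _ sup ell
  (hG.1 _ _ sI CN) (hG.1 _ _ sI CK) C2psi psioo.
have psiA t' y : s < t' <= t ->
    operatorA Q b t' (fun y => - K + 1 * phi y) y < - c * (- K + 1 * phi y).
  move=> /andP[st' _].
  rewrite (operatorA_addZ Q b t' 1 y (@C2_cst R d (- K)) C2phi) operatorA_cst.
  have := phiA t' y (le_trans t0s (ltW st')).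
  have : c * K = 2 * a by rewrite mulrC divfK ?gt_eqF.
  by move=> ? ?; nra.
have ini y : Num.min (phi y) N <= K + (- K + 1 * phi y).
  by rewrite ge_min; apply/orP; left; lra.
move=> /(_ psiA ini t x); rewrite st lexx => /(_ isT).
rewrite (evolution_Rintegral hG sI st (Bb_cst d K)) probability_Rintegral_cst.
set e := expR _ => /le_trans; apply.
have e0 : 0 < e by exact: expR_gt0.
have e1 : e <= 1.
  by rewrite -expR0 ler_expR mulNr oppr_le0 mulr_ge0 ?subr_ge0// ltW.
have := phi0 x; nra.
Qed.

(** * Ultrafilter limits and their countable additivity *)

Lemma ultra_bounded_cvg (R : realType) (T : Type) (F : set_system T)
    (h : T -> R) (M : R) :
  UltraFilter F -> F [set x | `|h x| <= M] -> cvg (h @ F).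
Proof.
move=> FU FM.
have FF : ProperFilter F by exact: ultra_proper.
have FI : F (h @^-1` `[- M, M]).
  by apply: filterS FM => x /=; rewrite in_itv/= ler_norml.
have [l [_ lcl]] := @segment_compact R (- M) M (h @ F) _ FI.
apply/cvg_ex; exists l => V lV.
(* An ultrafilter converges to each of its cluster points: if the preimage of a neighbourhood [V]
   were not in [F], its complement would be, and [l] would not be a cluster point. *)
have [//|FnV] := in_ultra_setVsetC (h @^-1` V) FU.
by have [y [nVy Vy]] := lcl (~` V) V FnV lV.
Qed.

(* The sublevel sets of [phi] make [L] tight, and tightness together with
   compactness gives the countable additivity of [L] at the constant [1]. *)
Lemma daniell_mean_of_tight (R : realType) (d : nat)
    (L : ('rV[R]_d -> R) -> R) (phi : 'rV[R]_d -> R) (C : R) :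
  (forall f g, Cb f -> Cb g -> L (fun x => f x + g x) = L f + L g) ->
  (forall k f, Cb f -> L (fun x => k * f x) = k * L f) ->
  (forall f, Cb_pos f -> 0 <= L f) -> L (fun=> 1) = 1 ->
  continuous phi -> (forall x, 0 <= phi x) -> tends_to_infinity phi ->
  (forall N, L (fun x => Num.min (phi x) N) <= C) ->
  daniell_mean L.
Proof.
move=> LD LZ L0 L1 cphi phi0 phioo LC; split=> // f Cf f1.
apply/lee_addgt0Pr => e e0.
(* Chosen so that [N^-1 * C <= e / 2]; the added 1 keeps [N] positive when [C] is 0. *)
pose N := 2 * (`|C| + 1) / e.
have N0 : 0 < N by rewrite divr_gt0// mulr_gt0// ltr_wpDl.
have [r rN] := phioo N.
have Cphi : Cb (fun x => Num.min (phi x) N) by exact: Cb_min.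
have CS n : Cb (fun x => \sum_(i < n) f i x) by apply: Cb_sum => i; exact: (Cf i).1.
have f0 i x : 0 <= f i x by exact: (Cf i).2.
pose P (n : nat) (x : 'rV[R]_d) := 1 - e / 2 < \sum_(i < n) f i x.
have Pmono m n x : (m <= n)%N -> P m x -> P n x.
  move=> mn /lt_le_trans; apply; rewrite -!(big_mkord xpredT (fun i => f i x)).
  by rewrite (big_cat_nat _ mn)//= lerDl sumr_ge0.
have Pex x : exists n, P n x.
  apply: contrapT => /forallNP nP.
  have : (\sum_(i <oo) (f i x)%:E <= (1 - e / 2)%:E)%E.
    apply: nneseries_le_bound => [n|n]; first by rewrite lee_fin.
    by rewrite big_mkord sumEFin lee_fin leNgt; apply/negP; exact: nP.
  by move=> /(le_trans (f1 x)); rewrite lee_fin; lra.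
(* As in Dini's theorem: the partial sums increase and are continuous, so by compactness one index
   [n] serves the whole ball. *)
have : \forall n \near \oo, [set x : 'rV[R]_d | `|x| <= r] `<=` P n.
  apply: (compact_near_coveringP _).1; first exact: compact_norm_le.
  move=> x _; have [n Pn] := Pex x.
  exists ([set y | P n y], [set m | (n <= m)%N]) => /=; last first.
    by move=> [y m] /= [Py nm]; exact: Pmono Py.
  split; last by exists n.
  apply: open_nbhs_nbhs; split=> //.
  apply: (@open_comp _ _ (fun y => \sum_(i < n) f i y) [set y | 1 - e / 2 < y]).
    by move=> y _; have [cS _] := CS n; exact: cS.
  exact: open_gt.
move=> [n _ /(_ n (leqnn n)) Kn].
(* On the ball the partial sum is large enough; off it [phi >= N], and the second term alone is 1.
   Applying [L] costs [e / 2] for that term and [e / 2] for the gap in the sum. *)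
have SN x : 1 - e / 2 <= \sum_(i < n) f i x + N^-1 * Num.min (phi x) N.
  have S0 : 0 <= \sum_(i < n) f i x by exact: sumr_ge0.
  have m0 : 0 <= N^-1 * Num.min (phi x) N.
    by rewrite mulr_ge0 ?invr_ge0 ?le_min ?phi0 ?ltW.
  have [xr|rx] := leP `|x| r; first by have := Kn x xr; rewrite /P; lra.
  rewrite min_r ?mulVf ?gt_eqF//; last first.
    by apply: rN; exact: lt_le_trans rx (norm_le_enorm _).
  lra.
have L00 : L (fun=> 0) = 0.
  rewrite -[RHS](mul0r (L (fun=> 0))) -LZ; last exact: Cb_cst.
  by congr L; apply/funext => x; rewrite mul0r.
have LSn : L (fun x => \sum_(i < n) f i x) = \sum_(i < n) L (f i).
  exact: (additive_Cb_sum n LD L00 (fun i => (Cf i).1)).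
have CN := CbZ N^-1 Cphi.
have Ce := @Cb_cst R d 1.
have := L0 (fun x => (\sum_(i < n) f i x + N^-1 * Num.min (phi x) N)
  + - (1 - e / 2) * 1).
rewrite (LD _ _ (CbD (CS n) CN) (CbZ _ Ce)) (LD _ _ (CS n) CN) (LZ _ _ Cphi).
rewrite (LZ _ _ Ce) L1 LSn => /(_ _) H.
have {}H : 1 - e <= \sum_(i < n) L (f i).
  have : N^-1 * L (fun x => Num.min (phi x) N) <= e / 2.
    rewrite mulrC ler_pdivrMr// (le_trans (LC N))//.
    have -> : e / 2 * N = `|C| + 1 by rewrite /N; field; rewrite gt_eqF.
    by have := ler_norm C; lra.
  suff : 0 <= \sum_(i < n) L (f i) + N^-1 * L (fun x => Num.min (phi x) N) +
     - (1 - e / 2) * 1 by lra.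
  apply: H; split; first by apply: CbD (CbZ _ Ce); exact: CbD.
  by move=> x; have := SN x; lra.
apply: (@le_trans _ _ ((\sum_(i < n) L (f i))%:E + e%:E)%E).
  by rewrite -EFinD lee_fin; lra.
apply: leeD => //; rewrite -sumEFin -(big_mkord xpredT (fun i => (L (f i))%:E)).
by apply: nneseries_lim_ge => i _ _; rewrite lee_fin L0.
Qed.

(** The base point 0 is arbitrary; another one would only replace [phi 0] in the final bound. *)
Definition evolution_mean (R : realType) (d : nat) (F : set_system R)
    (G : R -> R -> ('rV[R]_d -> R) -> 'rV[R]_d -> R)
    (s : R) (f : 'rV[R]_d -> R) : R :=
  lim (G r s f 0 @[r --> F]).

Lemma pinfty_nbhs_ge (R : realType) (s : R) : pinfty_nbhs R [set r | s <= r].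
Proof. by exists s; split; [exact: num_real|move=> r /ltW]. Qed.

Lemma evolution_mean_cvg (R : realType) (d : nat) (I : interval R)
    (Q : R -> 'rV[R]_d -> 'M[R]_d) (b : R -> 'rV[R]_d -> 'rV[R]_d)
    (p : R -> R -> 'rV[R]_d -> probability (Borel R d) R)
    (G : R -> R -> ('rV[R]_d -> R) -> 'rV[R]_d -> R)
    (F : set_system R) (s : R) (f : 'rV[R]_d -> R) :
  evolution_operator I Q b p G -> UltraFilter F -> pinfty_nbhs R `<=` F ->
  s \in I -> Cb f -> G r s f 0 @[r --> F] --> evolution_mean F G s f.
Proof.
move=> hG FU Foo sI Cf; have FF : ProperFilter F by exact: ultra_proper.
have [_ [M M0 fM]] := (CbP f).1 Cf.
have Fs : F [set r | s <= r] by apply: Foo; exact: pinfty_nbhs_ge.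
apply: (@ultra_bounded_cvg _ _ _ _ M); apply: filterS Fs => r /= sr.
rewrite (evolution_Rintegral hG sI sr (Cb_Bb Cf)) ler_norml; apply/andP; split.
  rewrite -[leLHS](probability_Rintegral_cst (p r s 0)).
  apply: Bb_le_Rintegral; [exact: Bb_cst|exact: Cb_Bb|].
  by move=> x; have := fM x; rewrite ler_norml => /andP[].
rewrite -[leRHS](probability_Rintegral_cst (p r s 0)).
apply: Bb_le_Rintegral; [exact: Cb_Bb|exact: Bb_cst|].
by move=> x; have := fM x; rewrite ler_norml => /andP[].
Qed.

Lemma evolution_mean_eq (R : realType) (d : nat)
    (G : R -> R -> ('rV[R]_d -> R) -> 'rV[R]_d -> R)
    (F : set_system R) (s t : R) (f : 'rV[R]_d -> R) (g : R -> R) (l : R) :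
  UltraFilter F -> pinfty_nbhs R `<=` F ->
  g r @[r --> F] --> l ->
  (forall r, t <= r -> G r s f 0 = g r) -> evolution_mean F G s f = l.
Proof.
move=> FU Foo gl Gg; have FF : ProperFilter F by exact: ultra_proper.
apply: cvg_lim => //; apply: cvg_trans gl; apply: near_eq_cvg.
have Fs : F [set r | t <= r] by apply: Foo; exact: pinfty_nbhs_ge.
by apply: filterS Fs => r /= tr; rewrite Gg.
Qed.

Lemma evolution_mean_positive (R : realType) (d : nat) (I : interval R)
    (Q : R -> 'rV[R]_d -> 'M[R]_d) (b : R -> 'rV[R]_d -> 'rV[R]_d)
    (p : R -> R -> 'rV[R]_d -> probability (Borel R d) R)
    (G : R -> R -> ('rV[R]_d -> R) -> 'rV[R]_d -> R)
    (F : set_system R) (s : R) :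
  evolution_operator I Q b p G -> UltraFilter F -> pinfty_nbhs R `<=` F ->
  s \in I ->
  let L := evolution_mean F G s in
  [/\ forall f g, Cb f -> Cb g -> L (fun x => f x + g x) = L f + L g,
      forall k f, Cb f -> L (fun x => k * f x) = k * L f,
      forall f, Cb_pos f -> 0 <= L f &
      L (fun=> 1) = 1].
Proof.
move=> hG FU Foo sI L; have FF : ProperFilter F by exact: ultra_proper.
have Lc f (Cf : Cb f) := evolution_mean_cvg hG FU Foo sI Cf.
have GE r f : s <= r -> Cb f -> G r s f 0 = \int[p r s 0]_y f y.
  by move=> sr Cf; rewrite (evolution_Rintegral hG sI sr (Cb_Bb Cf)).
split.
- move=> f g Cf Cg; apply: (evolution_mean_eq (t := s) FU Foo (cvgD (Lc f Cf) (Lc g Cg))).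
  move=> r sr; rewrite (GE _ _ sr (CbD Cf Cg)) (Bb_RintegralD _ (Cb_Bb Cf) (Cb_Bb Cg)).
  by rewrite -(GE _ _ sr Cf) -(GE _ _ sr Cg).
- move=> k f Cf; apply: (evolution_mean_eq (t := s) FU Foo (cvgMl_tmp (Lc f Cf))).
  move=> r sr; rewrite (GE _ _ sr (CbZ k Cf)) (GE _ _ sr Cf).
  by rewrite Bb_RintegralZ//; exact: Cb_Bb.
- move=> f [Cf f0]; apply: (limr_ge (cvgP _ (Lc f Cf))).
  have Fs : F [set r | s <= r] by apply: Foo; exact: pinfty_nbhs_ge.
  apply: filterS Fs => r /= sr; rewrite (GE _ _ sr Cf).
  rewrite -(probability_Rintegral_cst (p r s 0) 0).
  by apply: Bb_le_Rintegral => //; [exact: Bb_cst|exact: Cb_Bb].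
- apply: (@evolution_mean_eq _ _ G F s s _ (fun=> 1) 1 FU Foo).
    exact: cvg_cst.
  move=> r sr.
  by rewrite (GE _ _ sr (@Cb_cst R d 1)) probability_Rintegral_cst.
Qed.

Lemma evolution_mean_law (R : realType) (d : nat) (I : interval R)
    (Q : R -> 'rV[R]_d -> 'M[R]_d) (b : R -> 'rV[R]_d -> 'rV[R]_d)
    (p : R -> R -> 'rV[R]_d -> probability (Borel R d) R)
    (G : R -> R -> ('rV[R]_d -> R) -> 'rV[R]_d -> R)
    (F : set_system R) (s t : R) (f : 'rV[R]_d -> R) :
  line_or_right_halfline I -> uniformly_elliptic I Q ->
  lyapunov_condition I Q b -> evolution_operator I Q b p G ->
  UltraFilter F -> pinfty_nbhs R `<=` F ->
  s \in I -> s <= t -> Cb f ->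
  evolution_mean F G t (G t s f) = evolution_mean F G s f.
Proof.
move=> hI ell lya hG FU Foo sI st Cf.
apply: (evolution_mean_eq (t := t) FU Foo (evolution_mean_cvg hG FU Foo sI Cf)).
by move=> r tr; rewrite (evolution_law hI ell lya hG sI st tr Cf).
Qed.

(** This serves times before [t0], where no dissipative estimate is assumed. A cover of 1 by
    functions [f i] stays a cover after integration against [kap x], by interchanging sum and
    integral, so additivity at 1 is inherited from [L]. *)
Lemma daniell_mean_pullback (R : realType) (d : nat)
    (L L' : ('rV[R]_d -> R) -> R) (kap : 'rV[R]_d -> probability (Borel R d) R) :
  daniell_mean L ->
  (forall f, Cb f -> Cb (fun x => \int[kap x]_y f y)) ->
  (forall f, Cb f -> L' f = L (fun x => \int[kap x]_y f y)) ->
  daniell_mean L'.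
Proof.
move=> [LD LZ L0 L1 Ls] Ck L'E; split=> [f g Cf Cg|k f Cf|f [Cf f0]||f Cf f1].
- rewrite !L'E//; last exact: CbD.
  rewrite -LD; [|exact: Ck|exact: Ck]; congr L; apply/funext => x.
  by rewrite Bb_RintegralD//; exact: Cb_Bb.
- rewrite !L'E//; last exact: CbZ.
  rewrite -LZ; last exact: Ck; congr L; apply/funext => x.
  by rewrite Bb_RintegralZ//; exact: Cb_Bb.
- rewrite L'E//; apply: L0; split=> [|x]; first exact: Ck.
  rewrite -(probability_Rintegral_cst (kap x) 0).
  by apply: Bb_le_Rintegral => //; [exact: Bb_cst|exact: Cb_Bb].
- rewrite L'E; last exact: Cb_cst.
  rewrite -[RHS]L1; congr L; apply/funext => x.
  by rewrite probability_Rintegral_cst.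
- have Cbf i : Cb (f i) by exact: (Cf i).1.
  rewrite (eq_eseriesr (g := fun i => (L (fun x => \int[kap x]_y f i y))%:E));
    last by move=> i _; rewrite L'E.
  apply: Ls => [i|x].
    split=> [|x]; first exact: Ck.
    rewrite -(probability_Rintegral_cst (kap x) 0).
    by apply: Bb_le_Rintegral => //; [exact: Bb_cst|exact: Cb_Bb|exact: (Cf i).2].
  rewrite (eq_eseriesr (g := fun i => (\int[kap x]_y (f i y)%:E)%E)); last first.
    by move=> i _; rewrite Bb_EFin_Rintegral//; exact: Cb_Bb.
  have mf i : measurable_fun [set: Borel R d] (fun y : Borel R d => (f i y)%:E).
    by apply/measurable_EFinP; have [] := Cb_Bb (Cbf i).
  have f0 i y : (0 <= (f i y)%:E)%E by rewrite lee_fin; exact: (Cf i).2.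
  rewrite -integral_nneseries//.
  have -> : 1%E = (\int[kap x]_y (cst 1%:E y))%E :> \bar R.
    by rewrite integral_cst// mul1e; apply/esym; exact: probability_setT.
  apply: ge0_le_integral => //.
  apply: ge0_emeasurable_sum => //.
Qed.

(** The function [phi] is unbounded and outside the reach of the representation on [Cb]; monotone
    convergence recovers its integral from the truncations. *)
Lemma integral_le_of_min (R : realType) (d : nat)
    (P : probability (Borel R d) R) (phi : 'rV[R]_d -> R) (M : R) :
  continuous phi -> (forall x, 0 <= phi x) ->
  (forall N, \int[P]_x Num.min (phi x) N <= M) ->
  (\int[P]_x (phi x)%:E <= M%:E)%E.
Proof.
move=> cphi phi0 phiM.
have Cm (n : nat) : Cb (fun x => Num.min (phi x) n%:R) by exact: Cb_min.
have lim_min (x : Borel R d) :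
    (Num.min (phi x) n%:R)%:E @[n --> \oo] --> (phi x)%:E.
  apply: cvg_near_cst; exists (Num.bound (phi x)) => // n /= phin.
  rewrite min_l// ltW// (lt_le_trans (archi_boundP (phi0 x)))//.
  by rewrite ler_nat.
rewrite (_ : (\int[P]_x (phi x)%:E)%E =
    (\int[P]_x limn (fun n => (Num.min (phi x) n%:R)%:E))%E); last first.
  by apply: eq_integral => x _; apply/esym/cvg_lim => //; exact: lim_min.
have H : (\int[P]_x (Num.min (phi x) n%:R)%:E)%E @[n --> \oo] -->
    (\int[P]_x limn (fun n => (Num.min (phi x) n%:R)%:E))%E.
  apply: (@cvg_monotone_convergence _ (Borel R d) R P setT measurableT
    (fun n x => (Num.min (phi x) n%:R)%:E)) => //.
  - by move=> n; apply/measurable_EFinP; have [] := Cb_Bb (Cm n).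
  - by move=> n x _; rewrite lee_fin le_min phi0/=.
  - move=> x _; apply/nondecreasing_seqP => n; rewrite lee_fin.
    by rewrite le_min !ge_min lexx/= ler_nat leqnSn orbT.
rewrite -(cvg_lim _ H)//; apply: lime_le; first by apply/cvg_ex; eexists; exact: H.
by apply: nearW => n; rewrite Bb_EFin_Rintegral ?lee_fin//; exact: Cb_Bb.
Qed.

Theorem theorem5p4 (R : realType) (d : nat) (hd : (1 <= d)%N)
    (I : interval R) (hI : line_or_right_halfline I)
    (Q : R -> 'rV[R]_d -> 'M[R]_d) (b : R -> 'rV[R]_d -> 'rV[R]_d)
    (h1 : holder_coefficients I Q b)
    (h2 : uniformly_elliptic I Q)
    (h3 : lyapunov_condition I Q b)
    (p : R -> R -> 'rV[R]_d -> probability (Borel R d) R)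
    (G : R -> R -> ('rV[R]_d -> R) -> 'rV[R]_d -> R)
    (hG : evolution_operator I Q b p G)
    (phi : 'rV[R]_d -> R) (a c t0 : R)
    (hphi : C2 phi) (hphi0 : forall x, 0 <= phi x)
    (hphioo : tends_to_infinity phi)
    (ha : 0 < a) (hc : 0 < c) (ht0 : t0 \in I)
    (hphiA : forall t x, t0 <= t -> operatorA Q b t phi x <= a - c * phi x) :
  exists (mu : R -> probability (Borel R d) R) (M : R),
    [/\ evolution_system_of_measures I G mu,
        0 <= M &
        forall t, t0 <= t -> (\int[mu t]_y (phi y)%:E <= M%:E)%E].
Proof.
have [F [FU Foo]] := ultraFilterLemma (@proper_pinfty_nbhs R).
have FF : ProperFilter F by exact: ultra_proper.
(* The pointwise bound of [evolution_lyapunov_le] at the base point 0; it depends neither on the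
   times nor on the truncation level. *)
set M := phi 0 + 2 * a / c.
have [cphi _ _ _] := hphi.
have tight s N : s \in I -> t0 <= s ->
    evolution_mean F G s (fun x => Num.min (phi x) N) <= M.
  move=> sI t0s; have CN : Cb (fun x => Num.min (phi x) N) by exact: Cb_min.
  apply: (limr_le (cvgP _ (evolution_mean_cvg hG FU Foo sI CN))).
  apply: filterS (Foo _ (pinfty_nbhs_ge s)) => r /= sr.
  exact: (evolution_lyapunov_le N 0 hI h2 hG hphi hphi0 hphioo ha hc hphiA).
have dm_ge s : s \in I -> t0 <= s -> daniell_mean (evolution_mean F G s).
  move=> sI t0s; have [LD LZ L0 L1] := evolution_mean_positive hG FU Foo sI.
  apply: (daniell_mean_of_tight LD LZ L0 L1 cphi hphi0 hphioo (C := M)) => N.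
  exact: tight.
have Cp s t f : s \in I -> s <= t -> Cb f -> Cb (fun x => \int[p t s x]_y f y).
  move=> sI st Cf; rewrite -(evolution_Rintegral hG sI st (Cb_Bb Cf)).
  exact: (evolution_Cb hG).
have lawp s t f : s \in I -> s <= t -> Cb f -> evolution_mean F G s f =
    evolution_mean F G t (fun x => \int[p t s x]_y f y).
  move=> sI st Cf; rewrite -(evolution_Rintegral hG sI st (Cb_Bb Cf)).
  by rewrite (evolution_mean_law hI h2 h3 hG FU Foo sI st Cf).
have dm s : s \in I -> daniell_mean (evolution_mean F G s).
  move=> sI; have [t0s|/ltW st0] := leP t0 s; first exact: dm_ge.
  apply: (daniell_mean_pullback (kap := p t0 s) (dm_ge _ ht0 (lexx _))) => f Cf.
    exact: Cp.
  exact: lawp.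
(* The family is indexed by all reals; outside [I] any probability measure will do, and the one
   found at [t0] is taken. *)
have /choice[mu muE] : forall s, exists P : probability (Borel R d) R,
    s \in I -> forall f, Cb f -> \int[P]_x f x = evolution_mean F G s f.
  move=> s; have [sI|nsI] := pselect (s \in I).
    by have [P PE] := daniell_representation (dm s sI); exists P.
  by have [P _] := daniell_representation (dm t0 ht0); exists P => /nsI.
have M0 : 0 <= M.
  by rewrite addr_ge0// divr_ge0 ?mulr_ge0 ?ltW.
exists mu, M; split=> // [s t f sI tI st Bf|t t0t].
  rewrite (evolution_Rintegral hG sI (ltW st) Bf).
  apply: integral_compose_Bb => // g Cg; first exact: (Cp _ _ _ sI (ltW st)).
  rewrite (muE t tI); last exact: (Cp _ _ _ sI (ltW st)).
  by rewrite (muE s sI _ Cg) (lawp _ _ _ sI (ltW st) Cg).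
have tI : t \in I by exact: halfline_up ht0 t0t.
apply: integral_le_of_min => // N; rewrite (muE t tI); first exact: tight.
exact: Cb_min.
Qed.
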